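(* Let $\{\sigma,\tau\}$ be any of the pairs $\{123,213\},\{132,213\},\{132,231\},\{132,312\},\{213,231\},\{213,312\},\{231,312\},\{231,321\},\{312,321\}$. Then for every $n$ and every $F\in\mathcal{F}_n$, $$|\mathcal{M}_F(\sigma,\tau)|=2^{\,n-r(F)},$$ so all these pairs are shape-Wilf-equivalent. Moreover $$\sum_{n\ge0}|\mathcal{M}_n(\sigma,\tau)|z^n=\frac{4}{3+\sqrt{1-8z}},\qquad |\mathcal{M}_{n+1}(\sigma,\tau)|=\frac{1}{n+1}\sum_{k=0}^{n}\binom{2n+2}{n-k}\binom{n+k}{k}\ (n\ge0),$$ and $$\sum_{n\ge0}|\mathcal{P}_n(\sigma,\tau)|z^n=\frac{2-3z+z^2-z\sqrt{1-6z+z^2}}{2(1-3z+3z^2)}.$$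
   Context: A Dyck path of semilength $n$ is a lattice path from $(0,n)$ to $(n,0)$ with unit east and south steps never going strictly below $y=n-x$. $\mathcal{F}_n$ is the set of Ferrers boards whose border $D_F$ is such a path. $r(F)$ is the number of returns of $D_F$: the number of its south steps that end on the line $y=n-x$. Perfect matchings of $[2n]$: sets of $n$ disjoint pairs $(i,j)$, $i<j$ ($i$ opener, $j$ closer). The shape of $M$ is the board in $\mathcal{F}_n$ whose border is obtained reading $1,\dots,2n$ and taking an east step per opener and a south step per closer. $M$ avoids $\tau\in S_k$ if there are no $i_1<\dots<i_{2k}$ with all pairs $(i_a,i_{2k+1-\tau(a)})$ in $M$. $\mathcal{M}_F(\sigma,\tau)$ (resp. $\mathcal{M}_n(\sigma,\tau)$) is the set of perfect matchings of shape $F$ (resp. of $[2n]$) avoiding both $\sigma$ and $\tau$. Pairs $\{\sigma,\tau\}$, $\{\sigma',\tau'\}$ are shape-Wilf-equivalent if $|\mathcal{M}_F(\sigma,\tau)|=|\mathcal{M}_F(\sigma',\tau')|$ for every Ferrers board $F$. Set partitions of $[n]$: for each block $\{i_1<\dots<i_a\}$ draw arcs $(i_1,i_2),\dots,(i_{a-1},i_a)$; a partition avoids $\tau\in S_k$ if there are no $i_1<\dots<i_{2k}$ with all arcs $(i_a,i_{2k+1-\tau(a)})$ present. $\mathcal{P}_n(\sigma,\tau)$ is the set of partitions of $[n]$ avoiding both. *)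

(* Defs.v *)
From HB Require Import structures.
From mathcomp Require Import all_boot all_order all_fingroup all_algebra.
From mathcomp Require Import boolp.

Set Implicit Arguments.
Unset Strict Implicit.
Unset Printing Implicit Defensive.

Import GRing.Theory.

Definition step := bool.
Definition East : step := true.
Definition South : step := false.

(* End vertex of the path that starts at (0, n) and follows [p].  The
   subtraction is exact as long as [p] has at most [n] south steps. *)
Definition end_vertex (n : nat) (p : seq step) : nat * nat :=
  (count_mem East p, n - count_mem South p).

(* The vertex (x, y) is weakly above the line y = n - x iff n <= x + y. *)
Definition dyck_path (n : nat) (p : seq step) : bool :=
  [&& size p == n.*2, end_vertex n p == (n, 0) &
      all (fun i => let v := end_vertex n (take i p) in n <= v.1 + v.2)
          (iota 0 (size p).+1)].

Definition path_returns (n : nat) (p : seq step) : nat :=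
  count (fun i => (nth East p i == South) &&
                  (let v := end_vertex n (take i.+1 p) in v.1 + v.2 == n))
        (iota 0 (size p)).

(* The cell (x, y) is the unit square with lower left corner (x, y): a board
   is justified to the left and to the bottom of the n x n array. *)
Definition ferrers_board (n : nat) (F : {set 'I_n * 'I_n}) : bool :=
  [forall c in F, forall d : 'I_n * 'I_n, (d.1 <= c.1) && (d.2 <= c.2) ==> (d \in F)].

Definition row_length (n : nat) (F : {set 'I_n * 'I_n}) (y : nat) : nat :=
  #|[set c in F | c.2 == y :> nat]|.

(* The border goes from (0, n) to (n, 0): the rows are read from the top one
   (y = n - 1) down, each south step being at the right end of its row. *)
Definition border (n : nat) (F : {set 'I_n * 'I_n}) : seq step :=
  flatten [seq rcons (nseq (row_length F y - row_length F y.+1) East) South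
          | y <- rev (iota 0 n)]
  ++ nseq (n - row_length F 0) East.

Definition dyck_boards (n : nat) : {set {set 'I_n * 'I_n}} :=
  [set F | ferrers_board F && dyck_path n (border F)].

Definition returns (n : nat) (F : {set 'I_n * 'I_n}) : nat :=
  path_returns n (border F).

Definition one_line (k : nat) (tau : 'S_k) : seq nat :=
  [seq (tau a).+1 | a <- enum 'I_k].

(* With indices starting at 0, the closer i_(2k+1-tau(a)) of the opener i_a
   has index 2k - 1 - tau(a): this is the reversal of tau(a) in 'I_(k + k). *)
Definition contains (N k : nat) (A : {set 'I_N * 'I_N}) (tau : 'S_k) : bool :=
  [exists i : {ffun 'I_(k + k) -> 'I_N},
     [forall a : 'I_(k + k), forall b : 'I_(k + k), (a < b) ==> (i a < i b)] &&
     [forall a : 'I_k,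
        (i (lshift k a), i (rev_ord (lshift k (tau a)))) \in A]].

Definition avoids (N k : nat) (A : {set 'I_N * 'I_N}) (tau : 'S_k) : bool :=
  ~~ contains A tau.

Definition perfect_matching (n : nat)
    (M : {set 'I_(n.*2) * 'I_(n.*2)}) : bool :=
  [&& #|M| == n,
      [forall p in M, p.1 < p.2] &
      [forall p in M, forall q in M,
         (p != q) ==> [disjoint [set p.1; p.2] & [set q.1; q.2]]]].

Definition matching_path (n : nat)
    (M : {set 'I_(n.*2) * 'I_(n.*2)}) : seq step :=
  [seq if [exists j, (i, j) \in M] then East else South
  | i <- enum 'I_(n.*2)].

Definition has_shape (n : nat) (M : {set 'I_(n.*2) * 'I_(n.*2)})
    (F : {set 'I_n * 'I_n}) : bool :=
  (F \in dyck_boards n) && (border F == matching_path M).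

Definition matchings (n k l : nat) (sigma : 'S_k) (tau : 'S_l) :
    {set {set 'I_(n.*2) * 'I_(n.*2)}} :=
  [set M | [&& perfect_matching M, avoids M sigma & avoids M tau]].

Definition matchings_of_shape (n k l : nat) (F : {set 'I_n * 'I_n})
    (sigma : 'S_k) (tau : 'S_l) : {set {set 'I_(n.*2) * 'I_(n.*2)}} :=
  [set M in matchings n sigma tau | has_shape M F].

Definition shape_wilf_equivalent (k l k' l' : nat)
    (sigma : 'S_k) (tau : 'S_l) (sigma' : 'S_k') (tau' : 'S_l') : Prop :=
  forall (n : nat) (F : {set 'I_n * 'I_n}), ferrers_board F ->
    #|matchings_of_shape F sigma tau| = #|matchings_of_shape F sigma' tau'|.

Definition arcs (n : nat) (P : {set {set 'I_n}}) : {set 'I_n * 'I_n} :=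
  [set p : 'I_n * 'I_n | (p.1 < p.2) &&
           [exists B in P, [&& p.1 \in B, p.2 \in B &
              ~~ [exists x in B, p.1 < x < p.2]]]].

Definition partitions (n k l : nat) (sigma : 'S_k) (tau : 'S_l) :
    {set {set {set 'I_n}}} :=
  [set P | [&& partition P [set: 'I_n],
               avoids (arcs P) sigma & avoids (arcs P) tau]].

Definition pattern_pairs : seq (seq nat * seq nat) :=
  [:: ([:: 1; 2; 3], [:: 2; 1; 3]);
      ([:: 1; 3; 2], [:: 2; 1; 3]);
      ([:: 1; 3; 2], [:: 2; 3; 1]);
      ([:: 1; 3; 2], [:: 3; 1; 2]);
      ([:: 2; 1; 3], [:: 2; 3; 1]);
      ([:: 2; 1; 3], [:: 3; 1; 2]);
      ([:: 2; 3; 1], [:: 3; 1; 2]);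
      ([:: 2; 3; 1], [:: 3; 2; 1]);
      ([:: 3; 1; 2], [:: 3; 2; 1])].

Definition is_pattern_pair (sigma tau : 'S_3) : Prop :=
  (one_line sigma, one_line tau) \in pattern_pairs \/
  (one_line tau, one_line sigma) \in pattern_pairs.

Local Open Scope ring_scope.

Record fps (R : Type) := Fps { fps_coef : nat -> R }.

Lemma fpsP (R : Type) (a b : fps R) :
  (forall n, fps_coef a n = fps_coef b n) -> a = b.
Proof. by case: a b => [f] [g] /= fg; congr Fps; apply/funext. Qed.

HB.instance Definition _ (R : Type) := gen_eqMixin (fps R).
HB.instance Definition _ (R : Type) := gen_choiceMixin (fps R).

Section FpsRing.
Variable R : comUnitRingType.
Implicit Types a b c : fps R.

Definition fps_add a b := Fps (fun n => fps_coef a n + fps_coef b n).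
Definition fps_opp a := Fps (fun n => - fps_coef a n).
Definition fps_zero : fps R := Fps (fun=> 0).

Fact fps_addA : associative fps_add.
Proof. by move=> a b c; apply: fpsP => n /=; rewrite addrA. Qed.
Fact fps_addC : commutative fps_add.
Proof. by move=> a b; apply: fpsP => n /=; rewrite addrC. Qed.
Fact fps_add0 : left_id fps_zero fps_add.
Proof. by move=> a; apply: fpsP => n /=; rewrite add0r. Qed.
Fact fps_addN : left_inverse fps_zero fps_opp fps_add.
Proof. by move=> a; apply: fpsP => n /=; rewrite addNr. Qed.

HB.instance Definition _ :=
  GRing.isZmodule.Build (fps R) fps_addA fps_addC fps_add0 fps_addN.

Definition fps_mul a b :=
  Fps (fun n => \sum_(i < n.+1) fps_coef a i * fps_coef b (n - i)%N).
Definition fps_one : fps R := Fps (fun n => (n == 0%N)%:R).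

Definition fps_trunc a (n : nat) : {poly R} := \poly_(i < n.+1) fps_coef a i.

Lemma coef_fps_trunc a n i : (i <= n)%N -> (fps_trunc a n)`_i = fps_coef a i.
Proof. by move=> le_in; rewrite coef_poly ltnS le_in. Qed.

Lemma coef_fps_mul a b (p q : {poly R}) n :
    (forall i, (i <= n)%N -> p`_i = fps_coef a i) ->
    (forall i, (i <= n)%N -> q`_i = fps_coef b i) ->
  forall i, (i <= n)%N -> (p * q)`_i = fps_coef (fps_mul a b) i.
Proof.
move=> pa qb i le_in; rewrite coefM; apply: eq_bigr => j _.
by rewrite pa ?qb ?(leq_trans _ le_in) ?leq_subr // -ltnS.
Qed.

Fact fps_mulC : commutative fps_mul.
Proof.
move=> a b; apply: fpsP => n; have [ta tb] := (@coef_fps_trunc a n, @coef_fps_trunc b n).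
by rewrite -(coef_fps_mul ta tb) // -(coef_fps_mul tb ta) // mulrC.
Qed.

Fact fps_mulA : associative fps_mul.
Proof.
move=> a b c; apply: fpsP => n.
have [ta tb tc] := And3 (@coef_fps_trunc a n) (@coef_fps_trunc b n)
                        (@coef_fps_trunc c n).
rewrite -(coef_fps_mul ta (coef_fps_mul tb tc)) //.
by rewrite -(coef_fps_mul (coef_fps_mul ta tb) tc) // mulrA.
Qed.

Fact fps_mul1 : left_id fps_one fps_mul.
Proof.
move=> a; apply: fpsP => n /=; rewrite big_ord_recl /= subn0 mul1r.
by rewrite big1 ?addr0 // => i _; rewrite mul0r.
Qed.

Fact fps_mulDl : left_distributive fps_mul fps_add.
Proof.
move=> a b c; apply: fpsP => n /=; rewrite -big_split.
by apply: eq_bigr => i _; rewrite /= mulrDl.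
Qed.

Fact fps_one_neq0 : fps_one != 0.
Proof.
by apply/eqP => /(congr1 (fun a => fps_coef a 0)) /eqP; rewrite /= oner_eq0.
Qed.

HB.instance Definition _ := GRing.Zmodule_isComNzRing.Build (fps R)
  fps_mulA fps_mulC fps_mul1 fps_mulDl fps_one_neq0.

Fixpoint fps_inv_coefs a (n : nat) : seq R :=
  if n is m.+1 then
    let s := fps_inv_coefs a m in
    rcons s (- (fps_coef a 0)^-1 *
             \sum_(i < m.+1) fps_coef a i.+1 * s`_(m - i))
  else [:: (fps_coef a 0)^-1].

Definition fps_unit : pred (fps R) := fun a => fps_coef a 0 \is a GRing.unit.
Definition fps_inv a : fps R :=
  if a \in fps_unit then Fps (fun n => (fps_inv_coefs a n)`_n) else a.

(* The square root with constant term 1 of a series with constant term 1. *)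
Fixpoint fps_sqrt_coefs a (n : nat) : seq R :=
  if n is m.+1 then
    let s := fps_sqrt_coefs a m in
    rcons s ((fps_coef a m.+1 - \sum_(i < m) s`_i.+1 * s`_(m - i)) / 2%:R)
  else [:: 1].

Definition fps_sqrt a : fps R := Fps (fun n => (fps_sqrt_coefs a n)`_n).

Lemma size_fps_inv_coefs a n : size (fps_inv_coefs a n) = n.+1.
Proof. by elim: n => //= n IHn; rewrite size_rcons IHn. Qed.

Lemma size_fps_sqrt_coefs a n : size (fps_sqrt_coefs a n) = n.+1.
Proof. by elim: n => //= n IHn; rewrite size_rcons IHn. Qed.

Lemma fps_inv_coefsE a n i :
  (i <= n)%N -> (fps_inv_coefs a n)`_i = (fps_inv_coefs a i)`_i.
Proof.
elim: n => [|n IHn]; first by rewrite leqn0 => /eqP->.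
rewrite leq_eqVlt => /predU1P[-> // | lt_in].
by rewrite [in LHS]/= nth_rcons size_fps_inv_coefs lt_in IHn.
Qed.

Lemma fps_sqrt_coefsE a n i :
  (i <= n)%N -> (fps_sqrt_coefs a n)`_i = (fps_sqrt_coefs a i)`_i.
Proof.
elim: n => [|n IHn]; first by rewrite leqn0 => /eqP->.
rewrite leq_eqVlt => /predU1P[-> // | lt_in].
by rewrite [in LHS]/= nth_rcons size_fps_sqrt_coefs lt_in IHn.
Qed.

Fact fps_mulV : {in fps_unit, left_inverse 1 fps_inv *%R}.
Proof.
move=> a ua; rewrite mulrC; apply: fpsP => n.
rewrite /fps_inv ua /= big_ord_recl /= subn0.
case: n => [|n]; first by rewrite big_ord0 addr0 divrr.
rewrite /= nth_rcons size_fps_inv_coefs ltnn eqxx.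
rewrite mulrA mulrN divrr // mulN1r.
apply/eqP; rewrite addrC subr_eq0; apply/eqP/eq_bigr => i _.
by rewrite /bump /= add1n subSS [in RHS]fps_inv_coefsE // leq_subr.
Qed.

Fact fps_unitP a b : b * a = 1 -> fps_unit a.
Proof.
move=> /(congr1 (fun c => fps_coef c 0)) /=.
rewrite big_ord_recl big_ord0 addr0 subn0 => ba1.
by apply/unitrP; exists (fps_coef b 0); split=> //; rewrite mulrC.
Qed.

Fact fps_invN : {in [predC fps_unit], fps_inv =1 id}.
Proof. by move=> a /negbTE; rewrite /fps_inv => ->. Qed.

HB.instance Definition _ :=
  GRing.ComNzRing_hasMulInverse.Build (fps R) fps_mulV fps_unitP fps_invN.

Lemma fps_sqrt0 a : fps_coef (fps_sqrt a) 0 = 1. Proof. by []. Qed.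

Lemma fps_sqrtK a : 2%:R \is a @GRing.unit R -> fps_coef a 0 = 1 ->
  fps_sqrt a ^+ 2 = a.
Proof.
move=> u2 a0; rewrite expr2; apply: fpsP => -[|n].
  by rewrite /= big_ord_recl big_ord0 addr0 mulr1 a0.
transitivity (\sum_(i < n.+2)
  (fps_sqrt_coefs a i)`_i * (fps_sqrt_coefs a (n.+1 - i))`_(n.+1 - i)) => //.
rewrite big_ord_recl big_ord_recr /= /bump /= add1n subnn subn0 mul1r mulr1.
rewrite nth_rcons size_fps_sqrt_coefs ltnn eqxx.
rewrite addrCA -mulr2n -[(_ / _) *+ 2]mulr_natr divrK // addrC.
apply/eqP; rewrite -addrA -[eqbRHS]addr0 (inj_eq (addrI _)) addrC subr_eq0.
apply/eqP/eq_bigr => i _; rewrite add1n subSS -/(fps_sqrt_coefs a i.+1).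
by rewrite !(@fps_sqrt_coefsE a n) ?leq_subr.
Qed.

End FpsRing.

Definition fpsX (R : comUnitRingType) : fps R := Fps (fun n => (n == 1%N)%:R).

(* Main.v *)
Require Import Defs.
From mathcomp Require Import all_boot all_order all_fingroup all_algebra.
From mathcomp Require Import zify ring.

Set Implicit Arguments.
Unset Strict Implicit.
Unset Printing Implicit Defensive.

Import GRing.Theory.

(** Matchings and partitions are arc diagrams: sets of arcs [(x, y)], [x < y], in
    which a vertex opens at most one arc and closes at most one.  With the sets of
    openers and of closers fixed, a diagram is a permutation from openers to
    closers satisfying lower bounds.  Delete the last opener together with its
    closer: what remains is described by the word listing the [h] openers then
    open in the order in which they get closed, a permutation avoiding two
    patterns of length 3, and putting the last opener back is inserting a new
    maximum in that word.  If the patterns of [S_3] are written as an ascent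
    (resp. descent) with the letter 3 inserted at place [alpha] (resp. [beta]),
    then for [alpha <= beta] exactly two sites are allowed when [h > 0], and one
    when [h = 0].  This covers six of the pairs; reversing the line inverts the
    patterns and gives the other three.  Hence a diagram type has weight 2 per
    opener that leaves a positive height, and the series follow from the
    recurrences of weighted lattice paths. *)

(** * Rook placements and active sites *)

Definition opener_weight (i b : nat) : nat := if b < i then 2 else b == i.

(* Of three openers closed at times [x], [y], [z], the last one is closed after
   [alpha] of the others if these are closed in order, after [beta] if not. *)
Definition bad_triple (alpha beta x y z : nat) : bool :=
  (x < z) + (y < z) == (if x < y then alpha else beta).

Lemma bad_triple_bump alpha beta j x y z :
  bad_triple alpha beta (bump j x) (bump j y) (bump j z) =
  bad_triple alpha beta x y z.
Proof.
have ltE u v : (bump j u < bump j v) = (u < v) by rewrite /bump; lia.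
by rewrite /bad_triple !ltE.
Qed.

Section Rooks.

Variables (alpha beta : nat) (b : nat -> nat).

Definition rooks m : {set 'S_m} :=
  [set s : 'S_m | [forall i : 'I_m, b i <= s i] &&
    [forall i1 : 'I_m, forall i2 : 'I_m, forall i3 : 'I_m,
      [&& i1 < i2, i2 < i3, b i3 <= s i1 & b i3 <= s i2] ==>
      ~~ bad_triple alpha beta (s i1) (s i2) (s i3)]].

Lemma rooksP m (s : 'S_m) :
  reflect ((forall i : 'I_m, b i <= s i) /\
           (forall i1 i2 i3 : 'I_m, i1 < i2 -> i2 < i3 ->
              b i3 <= s i1 -> b i3 <= s i2 ->
              ~~ bad_triple alpha beta (s i1) (s i2) (s i3)))
          (s \in rooks m).
Proof.
rewrite inE; apply: (iffP andP) => -[bs av]; split.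
- exact/forallP.
- move=> i1 i2 i3 i12 i23 b1 b2.
  by move/'forall_'forall_'forall_implyP: av; apply; rewrite i12 i23 b1 b2.
- exact/forallP.
- by apply/'forall_'forall_'forall_implyP => i1 i2 i3 /and4P[]; apply: av.
Qed.

(* The closers available to the last opener are those of index [j >= b m]. *)
Definition active_site m (s : 'S_m) (j : nat) : bool :=
  (b m <= j) && [forall i1 : 'I_m, forall i2 : 'I_m,
    [&& i1 < i2, b m <= s i1 & b m <= s i2] ==>
    ~~ bad_triple alpha beta (s i1) (s i2) j].

Lemma active_siteP m (s : 'S_m) j :
  reflect (b m <= j /\ forall i1 i2 : 'I_m, i1 < i2 ->
              b m <= s i1 -> b m <= s i2 ->
              (s i1 < j) + (s i2 < j) <> (if s i1 < s i2 then alpha else beta))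
          (active_site s j).
Proof.
apply: (iffP andP) => -[bj av]; split=> //.
  move=> i1 i2 i12 b1 b2 /eqP.
  by apply/negP; move/'forall_'forall_implyP: av; apply; rewrite i12 b1 b2.
by apply/'forall_'forall_implyP => i1 i2 /and3P[i12 b1 b2]; apply/eqP/av.
Qed.

Hypothesis b_homo : {homo b : i j / i <= j}.

Lemma lift_perm_rooks m (s : 'S_m) (j : 'I_m.+1) :
  (lift_perm ord_max j s \in rooks m.+1) = (s \in rooks m) && active_site s j.
Proof.
have liftE (i : 'I_m) : lift ord_max i = i :> nat.
  by rewrite /= /bump leqNgt ltn_ord.
have sE i : lift_perm ord_max j s (lift ord_max i) = bump j (s i) :> nat.
  by rewrite lift_perm_lift.
have sM : lift_perm ord_max j s ord_max = j by rewrite lift_perm_id.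
have bE c x : c <= j -> (c <= bump j x) = (c <= x) by rewrite /bump; lia.
have ltmax (i : 'I_m) : lift ord_max i < (ord_max : 'I_m.+1).
  by rewrite liftE /= ltn_ord.
have bltE x : (bump j x < j) = (x < j) by rewrite /bump; lia.
have bltb x y : (bump j x < bump j y) = (x < y) by rewrite /bump; lia.
apply/rooksP/andP => [[bs av]|[/rooksP[bs av] /active_siteP[bj act]]].
  have bj : b m <= j by have := bs ord_max; rewrite sM.
  have bij (i : 'I_m) : b i <= j by apply: leq_trans bj; apply/b_homo/ltnW.
  split.
    apply/rooksP; split=> [i|i1 i2 i3 i12 i23 b1 b2].
      by have := bs (lift ord_max i); rewrite liftE sE bE.
    have := av (lift ord_max i1) (lift ord_max i2) (lift ord_max i3).
    rewrite !sE !liftE !bE // bad_triple_bump; exact.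
  apply/active_siteP; split=> // i1 i2 i12 b1 b2.
  have := av (lift ord_max i1) (lift ord_max i2) ord_max.
  rewrite !sE sM ltmax !liftE !bE // /bad_triple !bltE bltb => /(_ i12 isT b1 b2).
  by move/eqP.
have bij (i : 'I_m) : b i <= j by apply: leq_trans bj; apply/b_homo/ltnW.
split=> [i|i1 i2 i3].
  case: (unliftP ord_max i) => [i' ->|->]; last by rewrite sM.
  by rewrite sE liftE bE.
case: (unliftP ord_max i1) => [i1' ->|->]; last first.
  by move=> lt1 _ _ _; have := ltn_ord i2; rewrite ltnS leqNgt lt1.
case: (unliftP ord_max i2) => [i2' ->|->]; last first.
  by move=> _ lt1; have := ltn_ord i3; rewrite ltnS leqNgt lt1.
case: (unliftP ord_max i3) => [i3' ->|->].
  by rewrite !sE !liftE !bE // bad_triple_bump; apply: av.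
rewrite !sE sM !liftE !bE // => i12 _ b1 b2; rewrite /bad_triple !bltE bltb.
by apply/eqP/act.
Qed.

Hypothesis alpha_beta : alpha <= beta <= 2.

(* In the word listing the openers that are still open in the order in which
   they get closed, the sites are determined by the position [p] of the last
   opener: the word avoids the patterns, so what precedes and what follows its
   maximum is constrained. *)
Lemma active_sites m (s : 'S_m) : s \in rooks m -> b m < m ->
  exists u v, [/\ b m <= u, u < v, v <= m &
    forall j, j <= m -> active_site s j = (j == u) || (j == v)].
Proof.
move=> /rooksP[bs av] ltB; set B := b m in ltB *.
pose v0 : 'I_m := Ordinal ltB.
have [p Bp pmax] : exists2 p : 'I_m, B <= p &
    forall v : 'I_m, B <= v -> v != p -> s^-1%g v < s^-1%g p.
  have [p Bp pm] := @arg_maxnP _ v0 (fun v : 'I_m => B <= v)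
                       (fun v : 'I_m => s^-1%g v : nat) (leqnn _).
  exists p => // v Bv vp; rewrite ltn_neqAle; apply/andP; split; last exact: pm.
  by apply: contra vp => /eqP/val_inj/perm_inj->.
have act j : j <= m -> active_site s j =
    (B <= j) && [forall v1 : 'I_m, forall v2 : 'I_m, (B <= v1 < v2) ==>
      ((v1 < j) + (v2 < j) !=
         if s^-1%g v1 < s^-1%g v2 then alpha else beta)].
  move=> lejm; apply/active_siteP/andP => -[Bj H]; split=> //.
    apply/'forall_'forall_implyP => v1 v2 /andP[B1 v12].
    have B2 : B <= v2 by lia.
    case: (ltngtP (s^-1%g v1) (s^-1%g v2)) => [lt|gt|eq].
    - by have := H _ _ lt; rewrite !permKV v12 => H'; apply/eqP/H'.
    - have := H _ _ gt; rewrite !permKV (ltnNge v2 v1) (ltnW v12) addnC => H'.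
      exact/eqP/H'.
    - by move/val_inj/perm_inj: eq => eq; rewrite eq ltnn in v12.
  move=> i1 i2 i12 B1 B2.
  have [lt|gt|/val_inj/perm_inj eq] := ltngtP (s i1) (s i2).
  - move/'forall_'forall_implyP: H => /(_ (s i1) (s i2)).
    by rewrite !permK B1 lt i12 => /(_ isT)/eqP.
  - move/'forall_'forall_implyP: H => /(_ (s i2) (s i1)).
    by rewrite !permK B2 gt (ltnNge i2) (ltnW i12) addnC => /(_ isT)/eqP.
  - by rewrite eq ltnn in i12.
have avp (v1 v2 : 'I_m) : B <= v1 -> v1 < v2 -> v1 != p -> v2 != p ->
    (v1 < p) + (v2 < p) != if s^-1%g v1 < s^-1%g v2 then alpha else beta.
  move=> B1 v12 n1 n2; have B2 : B <= v2 by lia.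
  have bp : b (s^-1%g p) <= B by apply/b_homo/ltnW.
  case: (ltngtP (s^-1%g v1) (s^-1%g v2)) => [lt|gt|eq].
  - have := av _ _ _ lt (pmax _ B2 n2); rewrite /bad_triple !permKV v12.
    by apply; apply: leq_trans bp _.
  - have := av _ _ _ gt (pmax _ B1 n1).
    rewrite /bad_triple !permKV (ltnNge v2 v1) (ltnW v12) addnC.
    by apply; apply: leq_trans bp _.
  - by move/val_inj/perm_inj: eq => eq; rewrite eq ltnn in v12.
have pm := ltn_ord p.
have desc (v : 'I_m) : p < v -> s^-1%g p < s^-1%g v = false.
  move=> pv; apply/negbTE; rewrite -leqNgt ltnW // pmax ?(leq_trans Bp (ltnW pv)) //.
  by rewrite -val_eqE /= gtn_eqF.
have asc (v : 'I_m) : B <= v -> v < p -> s^-1%g v < s^-1%g p.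
  by move=> Bv vp; rewrite pmax // -val_eqE /= ltn_eqF.
have site u v : B <= u -> u < v -> v <= m ->
    (forall j, (j == u) || (j == v) ->
       forall v1 v2 : 'I_m, B <= v1 -> v1 < v2 ->
        (v1 < j) + (v2 < j) != if s^-1%g v1 < s^-1%g v2 then alpha else beta) ->
    (forall j, B <= j <= m -> ~~ ((j == u) || (j == v)) ->
       exists v1 v2 : 'I_m, [/\ B <= v1, v1 < v2 &
        (v1 < j) + (v2 < j) = if s^-1%g v1 < s^-1%g v2 then alpha else beta]) ->
  exists u v, [/\ B <= u, u < v, v <= m &
    forall j, j <= m -> active_site s j = (j == u) || (j == v)].
  move=> Bu uv vm pos neg; exists u, v; split=> // j jm; rewrite act //.
  case: (boolP ((j == u) || (j == v))) => uvj.
    apply/andP; split; first by case/orP: uvj => /eqP->; lia.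
    by apply/'forall_'forall_implyP => v1 v2 /andP[]; apply: pos.
  apply/negP => /andP[Bj H].
  have [|v1 [v2 [B1 v12 E]]] := neg j _ uvj; first by rewrite Bj.
  by move/'forall_'forall_implyP: H => /(_ v1 v2); rewrite B1 v12 E eqxx => /(_ isT).
clear act av bs.
have mk (x : nat) : x < m -> {v : 'I_m | v = x :> nat} by move=> h; exists (Ordinal h).
have ne (v : 'I_m) : (v != p) = (v != p :> nat) by [].
have [eb|[eb|eb]] : beta = 0 \/ beta = 1 \/ beta = 2 by lia.
- have ea : alpha = 0 by lia.
  rewrite ea eb in avp site; apply: (site m.-1 m); try lia.
    by move=> j jm v1 v2 _ v12; rewrite if_same; have := ltn_ord v2; lia.
  move=> j Bj jm; have [|v1 e1] := mk j; first lia.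
  have [|v2 e2] := mk j.+1; first lia.
  by exists v1, v2; rewrite if_same; split; lia.
- have [ea|ea] : alpha = 0 \/ alpha = 1 by lia.
    rewrite ea eb in avp site; apply: (site p m); try lia.
      move=> j /orP[]/eqP-> v1 v2 B1 v12; have m2 := ltn_ord v2; last first.
        by rewrite m2; case: ifP => _; lia.
      have [e1|n1] := eqVneq v1 p; first by rewrite e1 in v12 *; rewrite desc //; lia.
      have [e2|n2] := eqVneq v2 p; first by rewrite e2 in v12 *; rewrite asc //; lia.
      exact: avp.
    move=> j Bj jm; have [lt|gt] := ltnP j p.
      have [|v1 e1] := mk j; first lia.
      by exists v1, p; rewrite asc; [split; lia|lia|lia].
    have [|v2 e2] := mk j; first lia.
    by exists p, v2; rewrite desc; [split; lia|lia].
  rewrite ea eb in avp site; apply: (site B m); try lia.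
    by move=> j /orP[]/eqP-> v1 v2 B1 v12; rewrite if_same; have := ltn_ord v2; lia.
  move=> j Bj jm; have [|v2 e2] := mk j; first lia.
  by exists v0, v2; rewrite if_same; split=> //=; lia.
- have [ea|[ea|ea]] : alpha = 0 \/ alpha = 1 \/ alpha = 2 by lia.
  + rewrite ea eb in avp site; apply: (site p p.+1); try lia.
      move=> j jp v1 v2 B1 v12.
      have [e1|n1] := eqVneq v1 p; first by rewrite e1 in v12 *; rewrite desc //; lia.
      have [e2|n2] := eqVneq v2 p; first by rewrite e2 in v12 *; rewrite asc //; lia.
      have := avp _ _ B1 v12 n1 n2; move: n1 n2; rewrite !ne.
      by case: ifP => _; lia.
    move=> j Bj jm; have [lt|gt] := ltnP j p.
      have [|v1 e1] := mk j; first lia.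
      by exists v1, p; rewrite asc; [split; lia|lia|lia].
    have [|v2 e2] := mk p.+1; first lia.
    by exists p, v2; rewrite desc; [split; lia|lia].
  + rewrite ea eb in avp site; apply: (site B p.+1); try lia.
      move=> j /orP[]/eqP-> v1 v2 B1 v12.
        by case: ifP => _; lia.
      have [e1|n1] := eqVneq v1 p; first by rewrite e1 in v12 *; rewrite desc //; lia.
      have [e2|n2] := eqVneq v2 p; first by rewrite e2 in v12 *; rewrite asc //; lia.
      have := avp _ _ B1 v12 n1 n2; move: n1 n2; rewrite !ne.
      by case: ifP => _; lia.
    move=> j Bj jm; have [lt|gt] := leqP j p.
      have [|v1 e1] := mk j.-1; first lia.
      by exists v1, p; rewrite asc; [split; lia|lia|lia].
    have [|v2 e2] := mk p.+1; first lia.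
    by exists p, v2; rewrite desc; [split; lia|lia].
  rewrite ea eb in avp site; apply: (site B B.+1); try lia.
    by move=> j jB v1 v2 B1 v12; rewrite if_same; lia.
  move=> j Bj jm; have [|v2 e2] := mk B.+1; first lia.
  by exists v0, v2; rewrite if_same; split=> //=; lia.
Qed.


Lemma card_active_sites m (s : 'S_m) : s \in rooks m ->
  \sum_(j < m.+1) active_site s j = opener_weight m (b m).
Proof.
rewrite /opener_weight => sr; have [ltB|gtB|eqB] := ltngtP (b m) m.
- have [u [v [Bu uv vm act]]] := active_sites sr ltB.
  have um : u < m.+1 by lia.
  rewrite (bigD1 (Ordinal um)) //= (bigD1 (Ordinal (vm : v < m.+1))) /=; last first.
    by rewrite -val_eqE /= gtn_eqF.
  rewrite !act ?eqxx ?orbT ?(ltnW um) //= big1 // => j /andP[].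
  by rewrite -!val_eqE /= act -1?ltnS // => /negbTE-> /negbTE->.
- rewrite big1 // => j _; apply/eqP; rewrite eqb0.
  by apply/negP => /andP[]; have := ltn_ord j; lia.
- rewrite (bigD1 ord_max) //= big1 => [|j]; last first.
    rewrite -val_eqE /= => jm; apply/eqP; rewrite eqb0.
    by apply/negP => /andP[]; have := ltn_ord j; lia.
  rewrite addn0; have -> // : active_site s m.
  apply/andP; rewrite eqB; split=> //.
  by apply/'forall_'forall_implyP => i1 i2; have := ltn_ord (s i1); lia.
Qed.

Lemma card_rooks m : #|rooks m| = \prod_(i < m) opener_weight i (b i).
Proof.
elim: m => [|m IHm].
  rewrite big_ord0; apply/eqP/cards1P; exists 1%g; apply/setP => s.
  rewrite !inE; apply/idP/eqP => _; first by apply/permP; case.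
  by apply/andP; split; apply/forallP; case.
rewrite big_ord_recr /= -IHm mulnC -[LHS]sum1_card.
pose f (p : 'S_m * 'I_m.+1) := lift_perm ord_max p.2 p.1.
have f_inj : injective f.
  move=> [s j] [s' j'] eq_f.
  have := congr1 (fun t : 'S_m.+1 => t ord_max) eq_f.
  rewrite /f /= !lift_perm_id => eq_j; rewrite -eq_j; congr (_, _).
  apply/permP => i; apply: (@lift_inj _ j).
  by rewrite -!(lift_perm_lift ord_max) {2}eq_j -/(f (s, j)) eq_f.
have f_bij : bijective f.
  by apply: inj_card_bij f_inj _; rewrite card_prod !card_Sn card_ord factS mulnC.
rewrite (reindex f) /=; last exact: onW_bij.
rewrite -(pair_big_dep predT (fun s j => f (s, j) \in rooks m.+1) (fun _ _ => 1)) /=.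
under eq_bigr => s _ do under eq_bigl => j do rewrite /f /= lift_perm_rooks.
rewrite (bigID (mem (rooks m))) /= [X in _ + X]big1 ?addn0 => [|s /negbTE s'].
  rewrite -[#|rooks m|]sum1_card big_distrr /=; apply: eq_bigr => s sr.
  rewrite sr muln1 -(card_active_sites sr) [RHS]big_mkcond /= big_mkcond /=.
  by apply: eq_bigr => j _; case: active_site.
by rewrite big_pred0 // => j; rewrite s'.
Qed.

End Rooks.

(** * Arc diagrams *)

Lemma containsP N k (A : {set 'I_N * 'I_N}) (tau : 'S_k) :
  reflect (exists x y : 'I_k -> 'I_N,
    [/\ forall a a' : 'I_k, a < a' -> x a < x a', forall a, (x a, y a) \in A,
        forall a a', x a < y a' &
        forall a a', (y a < y a') = (tau a' < tau a)])
  (contains A tau).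
Proof.
apply: (iffP existsP) => [[i /andP[mono arc]]|[x [y [mono arc lt_xy pat]]]].
  have {}mono (p q : 'I_(k + k)) : p < q -> i p < i q.
    by move=> pq; move/'forall_'forall_implyP: mono; apply.
  have imono (p q : 'I_(k + k)) : (i p < i q) = (p < q).
    have [/mono//|/mono/ltnW|/val_inj->] := ltngtP p q; last by rewrite ltnn.
    by rewrite leqNgt => /negbTE.
  exists (fun a => i (lshift k a)), (fun a => i (rev_ord (lshift k (tau a)))).
  split=> [a a' aa'|a|a a'|a a'].
  - exact: mono.
  - exact: (forallP arc).
  - by apply: mono; have [/=] := (ltn_ord a, ltn_ord (tau a')); lia.
  - by rewrite imono /=; have [/=] := (ltn_ord (tau a), ltn_ord (tau a')); lia.
pose i (p : 'I_(k + k)) := match split p with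
  | inl a => x a | inr b => y (tau^-1 (rev_ord b))%g end.
exists (finfun i); apply/andP; split.
  apply/'forall_'forall_implyP => p q; rewrite !ffunE /i.
  case: (split_ordP p) => a ->; case: (split_ordP q) => a' -> /=.
  - exact: mono.
  - by move=> _; apply: lt_xy.
  - by have := ltn_ord a'; lia.
  - rewrite pat !permKV /=.
    by have [] := (ltn_ord a, ltn_ord a'); lia.
apply/forallP => a; rewrite !ffunE /i (unsplitK (inl a)).
have -> : rev_ord (lshift k (tau a)) = rshift k (rev_ord (tau a)).
  by apply: val_inj => /=; have := ltn_ord (tau a); lia.
by rewrite (unsplitK (inr _)) rev_ordK permK.
Qed.

(* In an occurrence of [tau] the opener number [a] is closed the earlier the larger
   [tau a] is.  So, listing the three openers in the order in which they get
   closed, the first comes before the second iff [pattern_ascent tau], and the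
   third is preceded by [pattern_place tau] openers. *)
Definition pattern_ascent (tau : 'S_3) : bool :=
  tau (inord 1) < tau ord0.
Definition pattern_place (tau : 'S_3) : nat :=
  (tau (inord 2) < tau ord0) + (tau (inord 2) < tau (inord 1)).

Lemma forall_ord3 (P : 'I_3 -> Prop) :
  P ord0 -> P (inord 1) -> P (inord 2) -> forall a, P a.
Proof.
move=> P0 P1 P2 [[|[|[|a]]] lta] //.
- by have -> : Ordinal lta = ord0 by apply: val_inj.
- by have -> : Ordinal lta = inord 1 by apply: val_inj; rewrite /= inordK.
- by have -> : Ordinal lta = inord 2 by apply: val_inj; rewrite /= inordK.
Qed.

Lemma contains3P N (A : {set 'I_N * 'I_N}) (tau : 'S_3) :
  {in A &, injective (fun p : 'I_N * 'I_N => p.2)} ->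
  reflect (exists x1 x2 x3 y1 y2 y3 : 'I_N,
    [/\ x1 < x2 < x3, [&& (x1, y1) \in A, (x2, y2) \in A & (x3, y3) \in A],
        [&& x3 < y1, x3 < y2 & x3 < y3],
        (y1 < y2) = pattern_ascent tau &
        (y1 < y3) + (y2 < y3) = pattern_place tau])
  (contains A tau).
Proof.
move=> A_inj; apply: (iffP (containsP A tau)) => [[x [y [mono arc lt_xy pat]]]|].
  exists (x ord0), (x (inord 1)), (x (inord 2)), (y ord0), (y (inord 1)), (y (inord 2)).
  by split; rewrite ?arc ?lt_xy ?pat // !mono // !inordK.
move=> [x1 [x2 [x3 [y1 [y2 [y3 [x123 /and3P[A1 A2 A3] /and3P[l1 l2 l3] pA pP]]]]]]].
pose fx (t : 'I_N * 'I_N * 'I_N) (a : 'I_3) := nth t.1.1 [:: t.1.1; t.1.2; t.2] a.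
have fx0 t : fx t ord0 = t.1.1 by [].
have fx1 t : fx t (inord 1) = t.1.2 by rewrite /fx inordK.
have fx2 t : fx t (inord 2) = t.2 by rewrite /fx inordK.
exists (fx (x1, x2, x3)), (fx (y1, y2, y3)).
have neq_y x y x' y' : (x, y) \in A -> (x', y') \in A -> x < x' -> y != y' :> nat.
  move=> Ax Ax' ltx; apply/eqP => /val_inj eq_y.
  by have [eq_x _] := A_inj _ _ Ax Ax' eq_y; rewrite eq_x ltnn in ltx.
have n12 : y1 != y2 :> nat by apply: neq_y A1 A2 _; lia.
have n23 : y2 != y3 :> nat by apply: neq_y A2 A3 _; lia.
have n13 : y1 != y3 :> nat by apply: neq_y A1 A3 _; lia.
have neq_t a a' : a != a' -> tau a != tau a' :> nat.
  by apply: contra => /eqP/val_inj/perm_inj->.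
have t01 : tau ord0 != tau (inord 1) :> nat.
  by apply: neq_t; rewrite -val_eqE /= inordK.
have t02 : tau ord0 != tau (inord 2) :> nat.
  by apply: neq_t; rewrite -val_eqE /= inordK.
have t12 : tau (inord 1) != tau (inord 2) :> nat.
  by apply: neq_t; rewrite -val_eqE /= !inordK.
rewrite /pattern_ascent /pattern_place in pA pP.
split.
- apply: forall_ord3; apply: forall_ord3; rewrite ?fx0 ?fx1 ?fx2 ?inordK //=; lia.
- by apply: forall_ord3; rewrite ?fx0 ?fx1 ?fx2.
- apply: forall_ord3; apply: forall_ord3; rewrite ?fx0 ?fx1 ?fx2 /=; lia.
- apply: forall_ord3; apply: forall_ord3; rewrite ?fx0 ?fx1 ?fx2 /=; lia.
Qed.

Definition reverse_arcs N (A : {set 'I_N * 'I_N}) : {set 'I_N * 'I_N} :=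
  [set (rev_ord p.2, rev_ord p.1) | p in A].

Lemma mem_reverse_arcs N (A : {set 'I_N * 'I_N}) x y :
  ((x, y) \in reverse_arcs A) = ((rev_ord y, rev_ord x) \in A).
Proof.
apply/imsetP/idP => [[[x' y'] Axy [-> ->]]|Axy]; first by rewrite !rev_ordK.
by exists (rev_ord y, rev_ord x); rewrite //= !rev_ordK.
Qed.

Lemma reverse_arcsK N : involutive (@reverse_arcs N).
Proof. by move=> A; apply/setP => -[x y]; rewrite !mem_reverse_arcs !rev_ordK. Qed.

Lemma contains_reverse N k (A : {set 'I_N * 'I_N}) (tau : 'S_k) :
  contains (reverse_arcs A) tau^-1%g = contains A tau.
Proof.
have rev_lt (x y : 'I_N) : (rev_ord x < rev_ord y) = (y < x).
  by rewrite /=; have [] := (ltn_ord x, ltn_ord y); lia.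
have half (B : {set 'I_N * 'I_N}) (t : 'S_k) :
    contains B t -> contains (reverse_arcs B) t^-1%g.
  move=> /containsP[x [y [mono arc lt_xy pat]]]; apply/containsP.
  have xmono a a' : (x a < x a') = (a < a').
    have [/mono//|/mono/ltnW|/val_inj->] := ltngtP a a'; last by rewrite ltnn.
    by rewrite leqNgt => /negbTE.
  exists (fun a => rev_ord (y (t^-1%g a))), (fun a => rev_ord (x (t^-1%g a))).
  split=> [a a' aa'|a|a a'|a a'].
  - by rewrite rev_lt pat !permKV.
  - by rewrite mem_reverse_arcs !rev_ordK.
  - by rewrite rev_lt.
  - by rewrite rev_lt xmono.
apply/idP/idP; last exact: half.
by move/half; rewrite reverse_arcsK invgK.
Qed.

Definition arc_diagram N (A : {set 'I_N * 'I_N}) : bool :=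
  [&& [forall p in A, p.1 < p.2],
      [forall p in A, forall q in A, (p.1 == q.1) ==> (p == q)] &
      [forall p in A, forall q in A, (p.2 == q.2) ==> (p == q)]].

Lemma arc_diagramP N (A : {set 'I_N * 'I_N}) :
  reflect [/\ forall x y, (x, y) \in A -> x < y,
              {in A &, injective (fun p => p.1)} &
              {in A &, injective (fun p => p.2)}]
          (arc_diagram A).
Proof.
apply: (iffP and3P) => -[upA injl injr]; split.
- by move=> x y; move/forall_inP: upA; apply.
- move=> p q Ap Aq /eqP eq_pq; apply/eqP.
  by move/forall_inP: injl => /(_ p Ap)/forall_inP/(_ q Aq)/implyP; apply.
- move=> p q Ap Aq /eqP eq_pq; apply/eqP.
  by move/forall_inP: injr => /(_ p Ap)/forall_inP/(_ q Aq)/implyP; apply.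
- by apply/forall_inP => -[x y]; apply: upA.
- by do 2![apply/forall_inP => ? ?]; apply/implyP => /eqP/injl->.
- by do 2![apply/forall_inP => ? ?]; apply/implyP => /eqP/injr->.
Qed.

Definition openers N (A : {set 'I_N * 'I_N}) : {set 'I_N} := [set p.1 | p in A].
Definition closers N (A : {set 'I_N * 'I_N}) : {set 'I_N} := [set p.2 | p in A].

Lemma openersP N (A : {set 'I_N * 'I_N}) x :
  reflect (exists y, (x, y) \in A) (x \in openers A).
Proof.
apply: (iffP imsetP) => [[[x' y] Ax /= ->]|[y Axy]]; first by exists y.
by exists (x, y).
Qed.

Lemma closersP N (A : {set 'I_N * 'I_N}) y :
  reflect (exists x, (x, y) \in A) (y \in closers A).
Proof.
apply: (iffP imsetP) => [[[x y'] Ax /= ->]|[x Axy]]; first by exists x.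
by exists (x, y).
Qed.

Definition diagrams N (O K : {set 'I_N}) (sigma tau : 'S_3) :
    {set {set 'I_N * 'I_N}} :=
  [set A | [&& arc_diagram A, openers A == O, closers A == K,
               avoids A sigma & avoids A tau]].

Lemma diagrams_card_eq N (O K : {set 'I_N}) sigma tau A :
  A \in diagrams O K sigma tau -> #|O| = #|A| /\ #|K| = #|A|.
Proof.
rewrite inE => /and5P[/arc_diagramP[_ injl injr] /eqP<- /eqP<- _ _].
by rewrite !card_in_imset.
Qed.

Lemma monotone_enum N m (X : {set 'I_N}) : #|X| = m ->
  exists f : 'I_m -> 'I_N,
    (forall i j : 'I_m, i < j -> f i < f j) /\ f @: setT = X.
Proof.
move=> <-; exists (@enum_val _ (mem X)); split=> [i j ij|].
  have srt : sorted (fun x y : 'I_N => x < y) (enum X).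
    rewrite /enum_mem; apply: sorted_filter; first by move=> x y z; apply: ltn_trans.
    rewrite -enumT -(sorted_map (f := @nat_of_ord N) (e' := ltn)).
    by rewrite val_enum_ord iota_ltn_sorted.
  have x0 := enum_val i.
  rewrite !(enum_val_nth x0).
  by apply: (sorted_ltn_nth (leT := fun x y : 'I_N => x < y)) => //;
    [by move=> x y z; apply: ltn_trans | rewrite inE -cardE | rewrite inE -cardE].
apply/setP => x; apply/imsetP/idP => [[i _ ->]|Xx]; first exact: enum_valP.
by exists (enum_rank_in Xx x); rewrite // enum_rankK_in.
Qed.

Lemma card_ord_ltn m k : k <= m -> #|[set i : 'I_m | i < k]| = k.
Proof.
move=> km; have inj : injective (widen_ord km) by move=> i j [] /val_inj.
rewrite -[RHS]card_ord -(card_imset _ inj).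
apply: eq_card => i; rewrite inE; apply/idP/imsetP => [ik|[j _ ->]].
  by exists (Ordinal ik); last exact: val_inj.
exact: (ltn_ord j).
Qed.

Section Transfer.

Variables (N m : nat) (o c : 'I_m -> 'I_N).
Hypothesis o_mono : forall i j : 'I_m, i < j -> o i < o j.
Hypothesis c_mono : forall i j : 'I_m, i < j -> c i < c j.

Lemma mono_ltn (f : 'I_m -> 'I_N) : (forall i j : 'I_m, i < j -> f i < f j) ->
  forall i j, (f i < f j) = (i < j).
Proof.
move=> f_mono i j; have [/f_mono//|/f_mono/ltnW|/val_inj->] := ltngtP i j.
  by rewrite leqNgt => /negbTE.
by rewrite ltnn.
Qed.

Lemma mono_inj (f : 'I_m -> 'I_N) : (forall i j : 'I_m, i < j -> f i < f j) ->
  injective f.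
Proof.
move=> f_mono i j eq_f; have [/f_mono|/f_mono|/val_inj//] := ltngtP i j.
  by rewrite eq_f ltnn.
by rewrite eq_f ltnn.
Qed.

Definition closers_upto (n : nat) : nat :=
  #|[set k : 'I_m | [exists i : 'I_m, (i <= n) && (c k <= o i)]]|.

Lemma closers_upto_homo : {homo closers_upto : i j / i <= j}.
Proof.
move=> i j ij; apply/subset_leq_card/subsetP => k; rewrite !inE.
move=> /existsP[l /andP[li ckl]]; apply/existsP; exists l.
by rewrite (leq_trans li).
Qed.

Lemma closers_uptoE (i : 'I_m) : closers_upto i = #|[set k | c k <= o i]|.
Proof.
apply: eq_card => k; rewrite !inE; apply/existsP/idP => [[l /andP[li ck]]|ck].
  by apply: leq_trans ck _; rewrite leqNgt (mono_ltn o_mono) -leqNgt.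
by exists i; rewrite leqnn.
Qed.

Lemma closers_upto_le (i k : 'I_m) : (closers_upto i <= k) = (o i < c k).
Proof.
rewrite closers_uptoE; apply/idP/idP => [|lt].
  apply: contraTT; rewrite -leqNgt -ltnNge => le_ck.
  rewrite -[leqLHS](card_ord_ltn (ltn_ord k)).
  apply/subset_leq_card/subsetP => l; rewrite !inE ltnS => lk.
  by apply: leq_trans le_ck; rewrite leqNgt (mono_ltn c_mono) -leqNgt.
rewrite -[leqRHS](card_ord_ltn (ltnW (ltn_ord k))).
apply/subset_leq_card/subsetP => l; rewrite !inE => le_l.
by rewrite -(mono_ltn c_mono); apply: leq_ltn_trans le_l lt.
Qed.

Definition arcs_of_perm (s : 'S_m) : {set 'I_N * 'I_N} :=
  [set (o i, c (s i)) | i in setT].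

Lemma arcs_of_permP (s : 'S_m) x y :
  reflect (exists i, x = o i /\ y = c (s i)) ((x, y) \in arcs_of_perm s).
Proof.
apply: (iffP imsetP) => [[i _ [-> ->]]|[i [-> ->]]]; first by exists i.
by exists i.
Qed.

Lemma arcs_of_perm_inj : injective arcs_of_perm.
Proof.
move=> s t eq_st; apply/permP => i.
have : (o i, c (s i)) \in arcs_of_perm t by rewrite -eq_st; apply/arcs_of_permP; exists i.
by case/arcs_of_permP => j [/(mono_inj o_mono)-> /(mono_inj c_mono)].
Qed.

Lemma contains_arcs_of_perm (s : 'S_m) (tau : 'S_3) :
  reflect (exists i1 i2 i3 : 'I_m,
     [/\ i1 < i2 < i3, [&& closers_upto i3 <= s i1, closers_upto i3 <= s i2 &
           closers_upto i3 <= s i3],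
         (s i1 < s i2) = pattern_ascent tau &
         (s i1 < s i3) + (s i2 < s i3) = pattern_place tau])
   (contains (arcs_of_perm s) tau).
Proof.
have inj2 : {in arcs_of_perm s &, injective (fun p => p.2)}.
  move=> [x y] [x' y'] /arcs_of_permP[i [-> ->]] /arcs_of_permP[j [-> ->]] /=.
  by move/(mono_inj c_mono)/perm_inj->.
apply: (iffP (contains3P tau inj2)).
  move=> [x1 [x2 [x3 [y1 [y2 [y3 [x123 /and3P[A1 A2 A3] y_gt p1 p2]]]]]]].
  case/arcs_of_permP: A1 => i1 [e1 f1]; case/arcs_of_permP: A2 => i2 [e2 f2].
  case/arcs_of_permP: A3 => i3 [e3 f3]; exists i1, i2, i3.
  by move: x123 y_gt p1 p2; subst; rewrite !(mono_ltn o_mono) !(mono_ltn c_mono)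
    !closers_upto_le.
move=> [i1 [i2 [i3 [i123 s_ge p1 p2]]]].
exists (o i1), (o i2), (o i3), (c (s i1)), (c (s i2)), (c (s i3)).
rewrite !(mono_ltn o_mono) !(mono_ltn c_mono) -!closers_upto_le; split=> //.
by apply/and3P; split; apply/arcs_of_permP; [exists i1|exists i2|exists i3].
Qed.

Lemma arcs_of_perm_diagrams sigma tau :
  pattern_ascent sigma -> ~~ pattern_ascent tau ->
  diagrams (o @: setT) (c @: setT) sigma tau =
  arcs_of_perm @: rooks (pattern_place sigma) (pattern_place tau) closers_upto m.
Proof.
move=> asc /negbTE desc; apply/setP => A; apply/idP/imsetP; last first.
  move=> [s /rooksP[bs av] ->]; rewrite inE; apply/and5P; split.
  - apply/arc_diagramP; split.
    + by move=> x y /arcs_of_permP[i [-> ->]]; rewrite -closers_upto_le.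
    + move=> [x y] [x' y'] /arcs_of_permP[i [-> ->]] /arcs_of_permP[j [-> ->]] /=.
      by move/(mono_inj o_mono)->.
    + move=> [x y] [x' y'] /arcs_of_permP[i [-> ->]] /arcs_of_permP[j [-> ->]] /=.
      by move/(mono_inj c_mono)/perm_inj->.
  - apply/eqP/setP => x; apply/openersP/imsetP => [[y /arcs_of_permP[i [-> _]]]|[i _ ->]].
      by exists i.
    by exists (c (s i)); apply/arcs_of_permP; exists i.
  - apply/eqP/setP => y; apply/closersP/imsetP => [[x /arcs_of_permP[i [_ ->]]]|[i _ ->]].
      by exists (s i).
    by exists (o (s^-1%g i)); apply/arcs_of_permP; exists (s^-1%g i); rewrite permKV.
  - apply/negP => /contains_arcs_of_perm[i1 [i2 [i3 [/andP[i12 i23] /and3P[b1 b2 _] p1 p2]]]].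
    by have /negP[] := av _ _ _ i12 i23 b1 b2; rewrite /bad_triple p1 p2 asc.
  - apply/negP => /contains_arcs_of_perm[i1 [i2 [i3 [/andP[i12 i23] /and3P[b1 b2 _] p1 p2]]]].
    by have /negP[] := av _ _ _ i12 i23 b1 b2; rewrite /bad_triple p1 p2 desc.
rewrite inE => /and5P[/arc_diagramP[up injl injr] /eqP opA /eqP clA av1 av2].
have ex i : exists k, (o i, c k) \in A.
  have /openersP[y Ay] : o i \in openers A by rewrite opA imset_f.
  have /imsetP[k _ eq_y] : y \in c @: setT by rewrite -clA; apply/closersP; exists (o i).
  by exists k; rewrite -eq_y.
have [g Ag] := fin_all_exists ex.
have g_inj : injective g.
  move=> i j eq_g; have := injr _ _ (Ag i) (Ag j); rewrite /= eq_g => /(_ erefl).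
  by case=> /(mono_inj o_mono).
have eqA : A = arcs_of_perm (perm g_inj).
  apply/setP => -[x y]; apply/idP/arcs_of_permP => [Axy|[i [-> ->]]]; last by rewrite permE.
  have /imsetP[i _ eq_x] : x \in o @: setT by rewrite -opA; apply/openersP; exists y.
  exists i; split=> //; rewrite permE.
  by have [] := injl _ _ Axy (Ag i) eq_x.
exists (perm g_inj) => //; rewrite {}eqA in up av1 av2.
have bs (i : 'I_m) : closers_upto i <= perm g_inj i.
  by rewrite closers_upto_le; apply: up; apply/arcs_of_permP; exists i.
apply/rooksP; split=> // i1 i2 i3 i12 i23 b1 b2; apply/negP => /eqP bad.
case asc_i : (perm g_inj i1 < perm g_inj i2) bad => bad; [case/negP: av1 | case/negP: av2];
  apply/contains_arcs_of_perm; exists i1, i2, i3;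
  by split; rewrite ?i12 ?b1 ?b2 ?bs ?asc_i ?asc ?desc.
Qed.

Lemma card_arcs_of_perm_diagrams sigma tau :
  pattern_ascent sigma -> ~~ pattern_ascent tau ->
  pattern_place sigma <= pattern_place tau ->
  #|diagrams (o @: setT) (c @: setT) sigma tau| =
  \prod_(v in o @: setT) opener_weight #|[set u in o @: setT | u < v]|
                                       #|[set u in c @: setT | u <= v]|.
Proof.
move=> asc desc le_pl; rewrite arcs_of_perm_diagrams //.
have le2 : pattern_place sigma <= pattern_place tau <= 2.
  by rewrite le_pl; exact: (leq_add (leq_b1 _) (leq_b1 _)).
rewrite (card_imset _ arcs_of_perm_inj) (card_rooks closers_upto_homo le2).
rewrite big_imset /=; last by move=> i j _ _; apply: mono_inj.
apply: eq_big => [i|i _]; first by rewrite inE.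
rewrite closers_uptoE; congr opener_weight.
  have -> : [set u in o @: setT | u < o i] = o @: [set j : 'I_m | j < i].
    apply/setP => x; rewrite inE; apply/andP/imsetP => [[/imsetP[j _ ->]]|[j]].
      by rewrite (mono_ltn o_mono) => ji; exists j; rewrite ?inE.
    by rewrite inE => ji ->; rewrite imset_f ?(mono_ltn o_mono).
  by rewrite (card_imset _ (mono_inj o_mono)) card_ord_ltn 1?ltnW.
have -> : [set u in c @: setT | u <= o i] = c @: [set k | c k <= o i].
  apply/setP => x; rewrite inE; apply/andP/imsetP => [[/imsetP[j _ ->]]|[j]].
    by exists j; rewrite ?inE.
  by rewrite inE => ji ->; rewrite imset_f.
by rewrite (card_imset _ (mono_inj c_mono)).
Qed.

End Transfer.

(** * Weights of vertex types *)

(* The type of a vertex: is it an opener, is it a closer.  A vertex that is both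
   closes an arc before it opens one. *)
Definition vertex_type : Type := (bool * bool)%type.

Fixpoint type_weight (sel : pred vertex_type) (i b : nat)
    (t : seq vertex_type) : nat :=
  if t is x :: t' then
    (if sel x then opener_weight i (b + x.2) else 1) *
      type_weight sel (i + x.1) (b + x.2) t'
  else i == b.

Lemma type_weight_prod sel i b t x0 :
  type_weight sel i b t =
  (i + count fst t == b + count snd t) *
  \prod_(v < size t | sel (nth x0 t v))
    opener_weight (i + count fst (take v t)) (b + count snd (take v.+1 t)).
Proof.
elim: t i b => [|x t IHt] i b; first by rewrite big_ord0 /= !addn0 muln1.
rewrite /= IHt !addnA mulnCA big_mkcond [in RHS]big_mkcond big_ord_recl /=.
rewrite take0 /= !addn0; congr (_ * (_ * _)).
by apply: eq_bigr => v _; rewrite /bump /= !addnA.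
Qed.

Lemma type_weight_fst_lt i b t : i < b -> type_weight fst i b t = 0.
Proof.
elim: t i b => [|[[] c] t IHt] i b /= lt_ib; first by rewrite ltn_eqF.
  have lt_ibc : i < b + c by apply: leq_trans lt_ib (leq_addr _ _).
  by rewrite /opener_weight ltnNge (ltnW lt_ibc) gtn_eqF.
by rewrite mul1n addn0 IHt //; apply: leq_trans lt_ib (leq_addr _ _).
Qed.

Lemma opener_weightE i b : b <= i ->
  opener_weight i b = if i - b is 0 then 1 else 2.
Proof.
rewrite /opener_weight leq_eqVlt => /predU1P[->|ltb]; first by rewrite ltnn eqxx subnn.
by rewrite ltb; case E: (i - b) => //; lia.
Qed.

(* On a path the up steps leaving height [h] are matched with the down steps
   arriving at [h], so that weights may be moved from the former to the latter;
   [2 ^ (i - b).-1] is the product of the weights of the up steps below the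
   starting height [i - b]. *)
Lemma type_weight_fst_snd i b t : b <= i ->
  2 ^ (i - b).-1 * type_weight fst i b t = type_weight snd i b t.
Proof.
have powE h : 2 ^ h.+1.-1 = (if h is 0 then 1 else 2) * 2 ^ h.-1.
  by case: h => [|h] //; rewrite expnS.
elim: t i b => [|[o c] t IHt] i b /= le_bi.
  by case: eqP => [->|_]; rewrite ?subnn ?muln0.
case: c => /=; last first.
  rewrite addn0 mul1n; case: o => /=; last by rewrite addn0 mul1n IHt.
  rewrite -IHt; last lia.
  by rewrite addn1 subSn // powE opener_weightE // mulnA [_ * 2 ^ _]mulnC.
have [lt_bi|ge_bi] := ltnP b i; last first.
  have -> : b = i by lia.
  have -> : opener_weight i (i + 1) = 0.
    by rewrite /opener_weight addn1 ltnNge leqW // gtn_eqF.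
  by case: o => /=; rewrite ?mul0n ?muln0 // addn0 mul1n type_weight_fst_lt ?muln0 //; lia.
case: o => /=.
  rewrite -IHt; last lia.
  by rewrite subnDr mulnCA.
rewrite addn0 mul1n -IHt; last lia.
rewrite opener_weightE; last lia.
have -> : i - b = (i - (b + 1)).+1 by lia.
by rewrite powE mulnA.
Qed.

Lemma card_tnth_take (T : Type) (P : pred T) N (t : N.-tuple T) k : k <= N ->
  #|[set u : 'I_N | P (tnth t u) & u < k]| = count P (take k t).
Proof.
elim: k => [_|k IHk lt_kN].
  by rewrite take0 (_ : [set _ | _] = set0) ?cards0 //; apply/setP => u; rewrite !inE andbF.
pose u := Ordinal lt_kN; have x0 := tnth t u.
rewrite (take_nth x0) ?size_tuple // -cats1 count_cat -IHk 1?ltnW //.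
rewrite (cardsD1 u) !inE leqnn andbT /= addn0 (tnth_nth x0) addnC; congr (_ + _).
apply: eq_card => v; rewrite !inE -val_eqE /= ltnS leq_eqVlt.
by case: eqP => [->|_]; rewrite ?ltnn ?andbF //.
Qed.

Lemma card_tnth (T : Type) (P : pred T) N (t : N.-tuple T) :
  #|[set u : 'I_N | P (tnth t u)]| = count P t.
Proof.
rewrite -[X in count P X]take_size size_tuple -card_tnth_take //.
by apply: eq_card => u; rewrite !inE ltn_ord andbT.
Qed.

Definition type_openers N (t : N.-tuple vertex_type) : {set 'I_N} :=
  [set v | (tnth t v).1].
Definition type_closers N (t : N.-tuple vertex_type) : {set 'I_N} :=
  [set v | (tnth t v).2].
Definition type_of N (O K : {set 'I_N}) : N.-tuple vertex_type :=
  [tuple (v \in O, v \in K) | v < N].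

Lemma type_openers_of N (O K : {set 'I_N}) : type_openers (type_of O K) = O.
Proof. by apply/setP => v; rewrite inE tnth_mktuple. Qed.

Lemma type_closers_of N (O K : {set 'I_N}) : type_closers (type_of O K) = K.
Proof. by apply/setP => v; rewrite inE tnth_mktuple. Qed.

Lemma type_weight_sets N (t : N.-tuple vertex_type) (sel : pred vertex_type) :
  let O := type_openers t in let K := type_closers t in
  type_weight sel 0 0 t = (#|O| == #|K|) *
  \prod_(v | sel (tnth t v)) opener_weight #|[set u in O | u < v]|
                                           #|[set u in K | u <= v]|.
Proof.
move=> O K; rewrite (type_weight_prod _ _ _ _ (false, false)) !add0n.
rewrite /O /K !card_tnth; congr (_ * _).
rewrite (reindex (cast_ord (esym (size_tuple t)))) /=; last first.
  exists (cast_ord (size_tuple t)) => v _; first exact: cast_ordKV.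
  exact: cast_ordK.
apply: eq_big => [v|v _]; first by rewrite -tnth_nth.
rewrite !add0n -(card_tnth_take _ _ (ltnW (ltn_ord v))).
rewrite -(card_tnth_take _ _ (ltn_ord v)).
by congr opener_weight; apply: eq_card => u; rewrite !inE.
Qed.

Lemma prod_openers_closers N (O K : {set 'I_N}) : #|O| = #|K| ->
  \prod_(v in O) opener_weight #|[set u in O | u < v]| #|[set u in K | u <= v]| =
  \prod_(v in K) opener_weight #|[set u in O | u < v]| #|[set u in K | u <= v]|.
Proof.
move=> eq_OK; have := type_weight_fst_snd (type_of O K) (leqnn 0).
rewrite mul1n !type_weight_sets type_openers_of type_closers_of eq_OK eqxx !mul1n.
by congr (_ = _); apply: eq_bigl => v; rewrite tnth_mktuple.
Qed.

Definition reverse_set N (X : {set 'I_N}) : {set 'I_N} := @rev_ord N @: X.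

Lemma mem_reverse_set N (X : {set 'I_N}) v : (v \in reverse_set X) = (rev_ord v \in X).
Proof. by rewrite -{1}[v]rev_ordK (mem_imset _ _ rev_ord_inj). Qed.

Lemma card_reverse_set N (X : {set 'I_N}) : #|reverse_set X| = #|X|.
Proof. exact/card_imset/rev_ord_inj. Qed.

Lemma reverse_setK N : involutive (@reverse_set N).
Proof. by move=> X; apply/setP => v; rewrite !mem_reverse_set rev_ordK. Qed.

Lemma prod_reverse N (O K : {set 'I_N}) : #|O| = #|K| ->
  \prod_(v in reverse_set K)
    opener_weight #|[set u in reverse_set K | u < v]|
                  #|[set u in reverse_set O | u <= v]| =
  \prod_(v in O) opener_weight #|[set u in O | u < v]| #|[set u in K | u <= v]|.
Proof.
move=> eq_OK; rewrite (prod_openers_closers eq_OK) (reindex_inj rev_ord_inj) /=.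
apply: eq_big => [v|v _]; first by rewrite mem_reverse_set rev_ordK.
have revE (X : {set 'I_N}) (P : rel nat) :
    #|[set u in reverse_set X | P u (rev_ord v)]| = #|[set u in X | P (rev_ord u) (rev_ord v)]|.
  rewrite -(card_reverse_set [set u in X | _]); apply: eq_card => u.
  by rewrite mem_reverse_set !inE mem_reverse_set rev_ordK.
have eqK : #|K| = #|[set u in reverse_set K | u < rev_ord v]| + #|[set u in K | u <= v]|.
  rewrite (revE _ ltn) -(cardsID [set u : 'I_N | v < u]); congr (_ + _); apply: eq_card => u.
    by rewrite !inE /=; congr andb; have [] := (ltn_ord u, ltn_ord v); lia.
  by rewrite !inE -leqNgt andbC.
have eqO : #|O| = #|[set u in reverse_set O | u <= rev_ord v]| + #|[set u in O | u < v]|.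
  rewrite (revE _ leq) -(cardsID [set u : 'I_N | v <= u]); congr (_ + _); apply: eq_card => u.
    by rewrite !inE /=; congr andb; have [] := (ltn_ord u, ltn_ord v); lia.
  by rewrite !inE -ltnNge andbC.
have key a c d e : c + d = a + e -> opener_weight a c = opener_weight d e.
  rewrite /opener_weight => eq_sum.
  have -> : (c < a) = (e < d) by lia.
  by have -> : (c == a) = (e == d) by lia.
by apply: key; rewrite -eqO -eqK.
Qed.

Lemma arc_diagram_reverse N (A : {set 'I_N * 'I_N}) :
  arc_diagram (reverse_arcs A) = arc_diagram A.
Proof.
have half (B : {set 'I_N * 'I_N}) : arc_diagram B -> arc_diagram (reverse_arcs B).
  move=> /arc_diagramP[up injl injr]; apply/arc_diagramP; split.
  - move=> x y; rewrite mem_reverse_arcs => /up /=.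
    by have [] := (ltn_ord x, ltn_ord y); lia.
  - move=> [x y] [x' y']; rewrite !mem_reverse_arcs /= => Bxy Bxy' eq_x.
    by have := injr _ _ Bxy Bxy'; rewrite /= eq_x => /(_ erefl)/(congr1 fst)/rev_ord_inj/=->.
  - move=> [x y] [x' y']; rewrite !mem_reverse_arcs /= => Bxy Bxy' eq_y.
    by have := injl _ _ Bxy Bxy'; rewrite /= eq_y => /(_ erefl)/(congr1 snd)/rev_ord_inj/=->.
by apply/idP/idP; last exact: half; move/half; rewrite reverse_arcsK.
Qed.

Lemma openers_reverse N (A : {set 'I_N * 'I_N}) :
  openers (reverse_arcs A) = reverse_set (closers A).
Proof.
apply/setP => x; rewrite mem_reverse_set.
by apply/openersP/closersP => -[y]; rewrite ?mem_reverse_arcs => Ay;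
  exists (rev_ord y); rewrite ?mem_reverse_arcs ?rev_ordK.
Qed.

Lemma closers_reverse N (A : {set 'I_N * 'I_N}) :
  closers (reverse_arcs A) = reverse_set (openers A).
Proof. by rewrite -{2}[A]reverse_arcsK openers_reverse reverse_setK. Qed.

Lemma card_diagrams_reverse N (O K : {set 'I_N}) sigma tau :
  #|diagrams (reverse_set K) (reverse_set O) sigma^-1%g tau^-1%g| =
  #|diagrams O K sigma tau|.
Proof.
rewrite -[RHS](card_imset _ (inv_inj (@reverse_arcsK N))); apply: eq_card => A.
have [B ->] : exists B, A = reverse_arcs B.
  by exists (reverse_arcs A); rewrite reverse_arcsK.
rewrite (mem_imset _ _ (inv_inj (@reverse_arcsK N))) !inE /avoids !contains_reverse.
rewrite arc_diagram_reverse openers_reverse closers_reverse.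
by rewrite !(inj_eq (inv_inj (@reverse_setK N))) [(closers B == K) && _]andbCA.
Qed.

Lemma diagramsC N (O K : {set 'I_N}) sigma tau :
  diagrams O K sigma tau = diagrams O K tau sigma.
Proof. by apply/setP => A; rewrite !inE [avoids _ sigma && _]andbC. Qed.

Lemma one_lineE (tau : 'S_3) :
  one_line tau = [:: (tau ord0).+1; (tau (inord 1)).+1; (tau (inord 2)).+1].
Proof.
rewrite /one_line enum_ordSl enum_ordSl enum_ordSl enum_ord0 /=.
by congr [:: _; _; _]; congr (tau _).+1; apply: val_inj; rewrite /= inordK.
Qed.

Lemma one_line_inv (tau : 'S_3) :
  one_line tau^-1%g = [seq (index v (one_line tau)).+1 | v <- iota 1 3].
Proof.
rewrite -[iota 1 3]/[seq 1 + v | v <- iota 0 3] -(val_enum_ord 3) -2!map_comp.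
rewrite [LHS]/one_line.
apply: eq_map => i /=; rewrite -{2}[i](permKV tau); set j := (tau^-1)%g i.
rewrite add1n [in RHS]/one_line (index_map (f := fun a => (tau a).+1)).
  by rewrite index_enum_ord.
by move=> a a' [/val_inj/perm_inj].
Qed.

Lemma pattern_ascentE (tau : 'S_3) :
  pattern_ascent tau = (nth 0 (one_line tau) 1 < nth 0 (one_line tau) 0).
Proof. by rewrite one_lineE /= ltnS. Qed.

Lemma pattern_placeE (tau : 'S_3) :
  pattern_place tau = (nth 0 (one_line tau) 2 < nth 0 (one_line tau) 0) +
    (nth 0 (one_line tau) 2 < nth 0 (one_line tau) 1).
Proof. by rewrite one_lineE /= !ltnS. Qed.

Lemma card_diagrams N (O K : {set 'I_N}) sigma tau : is_pattern_pair sigma tau ->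
  #|diagrams O K sigma tau| = (#|O| == #|K|) *
   \prod_(v in O) opener_weight #|[set u in O | u < v]| #|[set u in K | u <= v]|.
Proof.
have [eq_OK|neq_OK] := eqVneq #|O| #|K|; last first.
  move=> _; apply: eq_card0 => A; apply/negP => /diagrams_card_eq[eO eK].
  by rewrite eO eK eqxx in neq_OK.
rewrite mul1n.
have direct (P Q : {set 'I_N}) (s t : 'S_3) : #|P| = #|Q| ->
    pattern_ascent s -> ~~ pattern_ascent t -> pattern_place s <= pattern_place t ->
  #|diagrams P Q s t| =
   \prod_(v in P) opener_weight #|[set u in P | u < v]| #|[set u in Q | u <= v]|.
  move=> eq_PQ asc desc le_pl.
  have [f [f_mono eP]] := @monotone_enum _ #|P| P erefl.
  have [g [g_mono eQ]] := @monotone_enum _ #|P| Q (esym eq_PQ).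
  by rewrite -eP -eQ; apply: card_arcs_of_perm_diagrams.
wlog: sigma tau / (one_line sigma, one_line tau) \in pattern_pairs.
  move=> IH [pat|pat]; first by apply: IH => //; left.
  by rewrite diagramsC; apply: IH => //; left.
move=> pat _.
have [[asc desc le_pl]|[asc desc le_pl]|[asc desc le_pl]|[asc desc le_pl]] :
   [\/ [/\ pattern_ascent sigma, ~~ pattern_ascent tau &
           pattern_place sigma <= pattern_place tau],
       [/\ pattern_ascent tau, ~~ pattern_ascent sigma &
           pattern_place tau <= pattern_place sigma],
       [/\ pattern_ascent sigma^-1%g, ~~ pattern_ascent tau^-1%g &
           pattern_place sigma^-1%g <= pattern_place tau^-1%g] |
       [/\ pattern_ascent tau^-1%g, ~~ pattern_ascent sigma^-1%g &
           pattern_place tau^-1%g <= pattern_place sigma^-1%g]].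
- move: pat; rewrite !pattern_ascentE !pattern_placeE !one_line_inv !inE /=.
  by do ![case/predU1P => [[-> ->]|]|move=> /eqP[-> ->]];
    do ?[by constructor 1|by constructor 2|by constructor 3|by constructor 4].
- exact: direct.
- by rewrite diagramsC; apply: direct.
- by rewrite -card_diagrams_reverse direct ?card_reverse_set // prod_reverse.
- by rewrite diagramsC -card_diagrams_reverse direct ?card_reverse_set // prod_reverse.
Qed.

Definition typed_diagrams N (q : pred vertex_type) (sigma tau : 'S_3) :
    {set {set 'I_N * 'I_N}} :=
  [set A | [&& arc_diagram A, [forall v, q (v \in openers A, v \in closers A)],
               avoids A sigma & avoids A tau]].

Lemma card_diagrams_type N (t : N.-tuple vertex_type) sigma tau :
  is_pattern_pair sigma tau ->
  #|diagrams (type_openers t) (type_closers t) sigma tau| = type_weight fst 0 0 t.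
Proof.
move=> pat; rewrite card_diagrams // type_weight_sets; congr (_ * _).
by apply: eq_bigl => v; rewrite inE.
Qed.

Definition total_weight (q : pred vertex_type) (N i b : nat) : nat :=
  \sum_(t : N.-tuple vertex_type | all q t) type_weight fst i b t.

Lemma card_typed_diagrams N (q : pred vertex_type) sigma tau :
  is_pattern_pair sigma tau ->
  #|typed_diagrams N q sigma tau| = total_weight q N 0 0.
Proof.
move=> pat; rewrite -sum1_card.
pose ty (A : {set 'I_N * 'I_N}) := type_of (openers A) (closers A).
rewrite (partition_big ty (fun t => all q t)) /=; last first.
  move=> A; rewrite inE => /and4P[_ qA _ _]; apply/(all_tnthP (t := ty A)) => v.
  by rewrite /ty /type_of tnth_mktuple; apply: (forallP qA).
apply: eq_bigr => t /all_tnthP qt; rewrite -(card_diagrams_type _ pat) -sum1_card.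
apply: eq_bigl => A; rewrite !inE; case: (arc_diagram A); rewrite //= -!andbA.
apply/idP/idP => [/and4P[_ av1 av2 /eqP <-]|/and4P[/eqP eO /eqP eK av1 av2]].
  by rewrite type_openers_of type_closers_of !eqxx av1 av2.
have eq_t : ty A = t.
  by apply: eq_from_tnth => v; rewrite /ty /type_of tnth_mktuple eO eK !inE -surjective_pairing.
rewrite eq_t eqxx av1 av2 !andbT; apply/forallP => v; have := qt v.
by rewrite -eq_t /ty /type_of tnth_mktuple.
Qed.

Lemma total_weight0 q i b : total_weight q 0 i b = (i == b).
Proof.
rewrite /total_weight (big_pred1 [tuple]) //= => t.
by rewrite (tuple0 t) /= eq_refl.
Qed.

Lemma total_weightS q N i b : total_weight q N.+1 i b =
  \sum_(x | q x) (if x.1 then opener_weight i (b + x.2) else 1) *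
                 total_weight q N (i + x.1) (b + x.2).
Proof.
rewrite /total_weight.
pose f (p : vertex_type * N.-tuple vertex_type) : N.+1.-tuple vertex_type :=
  [tuple of p.1 :: p.2].
rewrite (reindex f) /=; last first.
  exists (fun t : N.+1.-tuple vertex_type => (thead t, [tuple of behead t])).
    by move=> [x t] _; congr (_, _); apply: val_inj.
  by move=> t _; rewrite /f /= -tuple_eta.
under [RHS]eq_bigr => x _ do rewrite big_distrr /=.
by rewrite pair_big_dep.
Qed.

Lemma type_weight_shift sel i b t :
  type_weight sel i.+1 b.+1 t = type_weight sel i b t.
Proof.
elim: t i b => [|x t IHt] i b //=; rewrite !addSn IHt.
by rewrite /opener_weight ltnS eqSS.
Qed.

Lemma total_weight_shift q N h :
  total_weight q N h 1 = if h is h'.+1 then total_weight q N h' 0 else 0.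
Proof.
case: h => [|h].
  by rewrite /total_weight big1 // => t _; apply: type_weight_fst_lt.
by apply: eq_bigr => t _; apply: type_weight_shift.
Qed.

Definition height_weight (h : nat) : nat := if h is 0 then 1 else 2.

Lemma opener_weight_diag h b : opener_weight (h + b) b = height_weight h.
Proof. by rewrite opener_weightE ?leq_addl // addnK. Qed.

Lemma sum_vertex_type (q : pred vertex_type) (F : vertex_type -> nat) :
  \sum_(x | q x) F x =
  (if q (true, true) then F (true, true) else 0) +
  (if q (true, false) then F (true, false) else 0) +
  ((if q (false, true) then F (false, true) else 0) +
  (if q (false, false) then F (false, false) else 0)).
Proof.
rewrite big_mkcond.
transitivity (\sum_(o : bool) \sum_(c : bool) if q (o, c) then F (o, c) else 0).
  by rewrite pair_bigA; apply: eq_bigr => -[].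
by rewrite big_bool !big_bool.
Qed.

Definition matching_type : pred vertex_type := fun x => x.1 != x.2.

Lemma total_weight_matchingS N h :
  total_weight matching_type N.+1 h 0 =
  height_weight h * total_weight matching_type N h.+1 0 +
  (if h is h'.+1 then total_weight matching_type N h' 0 else 0).
Proof.
rewrite total_weightS sum_vertex_type /= !addn0 !add0n mul1n.
by rewrite total_weight_shift -{1}[h]addn0 opener_weight_diag addn1.
Qed.

Lemma total_weight_partitionS N h :
  total_weight predT N.+1 h 0 =
  total_weight predT N h 0 + height_weight h * total_weight predT N h.+1 0 +
  (if h is h'.+1 then total_weight predT N h' 0 +
                      height_weight h' * total_weight predT N h 0 else 0).
Proof.
rewrite total_weightS sum_vertex_type /= !addn0 !add0n !mul1n !total_weight_shift.
rewrite -{3}[h]addn0 opener_weight_diag addn1.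
case: h => [|h]; first by rewrite /= /opener_weight /= mul0n; lia.
by rewrite -{1}addn1 opener_weight_diag; lia.
Qed.

(** * Matchings and partitions as arc diagrams *)

Lemma matching_typeP N (A : {set 'I_N * 'I_N}) :
  [forall v, matching_type (v \in openers A, v \in closers A)] =
  (closers A == ~: openers A).
Proof.
apply/forallP/eqP => [H|-> v]; last by rewrite /matching_type /= inE; case: (_ \in _).
by apply/setP => v; have := H v; rewrite inE /matching_type /=; do 2!case: (_ \in _).
Qed.

Lemma card_openers_closers N (A : {set 'I_N * 'I_N}) : arc_diagram A ->
  #|openers A| = #|A| /\ #|closers A| = #|A|.
Proof. by case/arc_diagramP => _ injl injr; rewrite !card_in_imset. Qed.

Lemma perfect_matchingE n (M : {set 'I_(n.*2) * 'I_(n.*2)}) :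
  perfect_matching M = arc_diagram M && (closers M == ~: openers M).
Proof.
apply/and3P/andP => [[/eqP cardM upM disjM]|[diagM /eqP clM]].
  have up x y : (x, y) \in M -> x < y by move=> Mxy; apply: (forall_inP upM _ Mxy).
  have disj p q : p \in M -> q \in M -> p != q ->
      [&& p.1 != q.1, p.1 != q.2, p.2 != q.1 & p.2 != q.2].
    move=> Mp Mq neq_pq; move/forall_inP: disjM => /(_ p Mp)/forall_inP/(_ q Mq).
    rewrite neq_pq /= => /pred0P disj.
    apply/and4P; split; apply/eqP => eq_pq.
    - by have := disj p.1; rewrite /= !inE eq_pq eqxx.
    - by have := disj p.1; rewrite /= !inE eq_pq eqxx !orbT.
    - by have := disj p.2; rewrite /= !inE eq_pq eqxx !orbT.
    - by have := disj p.2; rewrite /= !inE eq_pq eqxx !orbT.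
  have diagM : arc_diagram M.
    apply/arc_diagramP; split=> // p q Mp Mq eq_pq; apply/eqP/negPn/negP => neq_pq;
      by have := disj p q Mp Mq neq_pq; rewrite eq_pq eqxx ?andbF.
  split=> //; have [cardO cardK] := card_openers_closers diagM.
  rewrite eqEcard subsetC; apply/andP; split.
    apply/subsetP => v /openersP[y Mvy]; rewrite inE; apply/negP => /closersP[x Mxv].
    have [[eq_xv _]|neq] := eqVneq (x, v) (v, y).
      by have := up _ _ Mxv; rewrite eq_xv ltnn.
    by have := disj _ _ Mxv Mvy neq; rewrite /= eqxx !andbF.
  by rewrite cardsCs setCK card_ord cardO cardK cardM -addnn addnK.
have [cardO cardK] := card_openers_closers diagM.
have /arc_diagramP[up injl injr] := diagM; split.
- by have := cardsC (openers M); rewrite -clM cardO cardK card_ord; lia.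
- by apply/forall_inP => -[x y]; apply: up.
- have OK p q : p \in M -> q \in M -> p.1 != q.2.
    move=> Mp Mq; apply/eqP => eq_pq.
    have : q.2 \in closers M by apply: imset_f.
    by rewrite clM inE -eq_pq imset_f.
  apply/forall_inP => p Mp; apply/forall_inP => q Mq; apply/implyP => neq_pq.
  apply/pred0P => v /=; rewrite !inE; apply/negbTE/negP.
  case/andP=> /orP[]/eqP-> /orP[]/eqP eq_pq; case/eqP: neq_pq.
  - exact: injl.
  - by have := OK _ _ Mp Mq; rewrite eq_pq eqxx.
  - by have := OK _ _ Mq Mp; rewrite eq_pq eqxx.
  - exact: injr.
Qed.

Lemma matchings_typed n (sigma tau : 'S_3) :
  matchings n sigma tau = typed_diagrams n.*2 matching_type sigma tau.
Proof. by apply/setP => M; rewrite !inE perfect_matchingE matching_typeP -andbA. Qed.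

Lemma count_iota_card N (P : pred nat) : count P (iota 0 N) = #|[set v : 'I_N | P v]|.
Proof. by rewrite -sum1_count -sum1dep_card -[N in iota 0 N]subn0 big_mkord. Qed.

Lemma matching_pathE n (M : {set 'I_(n.*2) * 'I_(n.*2)}) :
  matching_path M = [tuple v \in openers M | v < n.*2].
Proof.
rewrite /matching_path /=; apply: eq_map => v.
have -> : [exists j, (v, j) \in M] = (v \in openers M).
  by apply/existsP/openersP.
by case: (_ \in _).
Qed.

Lemma card_matchings_of_shape n (F : {set 'I_n * 'I_n}) sigma tau :
  is_pattern_pair sigma tau -> F \in dyck_boards n ->
  #|matchings_of_shape F sigma tau| = 2 ^ (n - returns F).
Proof.
move=> pat Fdyck; have := Fdyck; rewrite inE => /andP[_ /and3P[/eqP size_p]].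
rewrite /end_vertex => /eqP[countE countS] above.
pose p : n.*2.-tuple bool := Tuple (introT eqP size_p).
have p_border : border F = p by [].
pose O := [set v | tnth p v].
have -> : matchings_of_shape F sigma tau = diagrams O (~: O) sigma tau.
  apply/setP => M; rewrite inE matchings_typed !inE /has_shape Fdyck /=.
  rewrite matching_typeP matching_pathE p_border (inj_eq val_inj).
  have -> : (p == [tuple v \in openers M | v < n.*2]) = (openers M == O).
    apply/eqP/eqP => [eq_p|eO]; first by apply/setP => v; rewrite inE eq_p tnth_mktuple.
    by apply: eq_from_tnth => v; rewrite tnth_mktuple eO inE.
  case: (arc_diagram M) => //=; rewrite andbC.
  by case: eqP => //= ->.
have countES (s : seq bool) : count_mem East s + count_mem South s = size s.
  rewrite -(count_predC (pred1 East)); congr addn.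
  by apply: eq_count => -[].
have setE k : k <= n.*2 -> #|[set u in O | u < k]| = count_mem East (take k p).
  move=> lek; rewrite -(card_tnth_take (pred1 East) _ lek); apply: eq_card => u.
  by rewrite !inE; case: (tnth _ _).
have setS k : k <= n.*2 -> #|[set u in ~: O | u < k]| = count_mem South (take k p).
  move=> lek; rewrite -(card_tnth_take (pred1 South) _ lek); apply: eq_card => u.
  by rewrite !inE; case: (tnth _ _).
have cardO : #|O| = n.
  rewrite -[RHS]countE p_border -(card_tnth (pred1 East)); apply: eq_card => u.
  by rewrite !inE; case: (tnth _ _).
have cardK : #|~: O| = n.
  by have := cardsC O; rewrite card_ord cardO; lia.
rewrite card_diagrams // cardO cardK eqxx mul1n prod_openers_closers ?cardO ?cardK //.
pose ret (v : 'I_(n.*2)) := count_mem South (take v.+1 p) == count_mem East (take v.+1 p).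
have totS : count_mem South p = n.
  by have := countES p; rewrite -{1}p_border countE size_tuple; lia.
have leS k : count_mem South (take k p) <= n.
  by rewrite -[leqRHS]totS -{2}(cat_take_drop k p) count_cat leq_addr.
have le_SE k : k <= n.*2 -> count_mem South (take k p) <= count_mem East (take k p).
  move=> lek; move/allP: above => /(_ k).
  rewrite mem_iota size_p ltnS lek => /(_ isT) /=; rewrite p_border.
  by have := leS k; move: (count_mem South _) (count_mem East _) => a c; clear; lia.
have -> : returns F = #|[set v in ~: O | ret v]|.
  rewrite /returns /path_returns size_p count_iota_card; apply: eq_card => v.
  rewrite !inE p_border -tnth_nth /ret; congr andb; first by case: (tnth _ _).
  have := leS v.+1; have := le_SE v.+1 (ltn_ord v); rewrite /end_vertex /=.
  by move: (count_mem South _) (count_mem East _) => a c; clear; lia.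
have -> : n - #|[set v in ~: O | ret v]| = #|[set v in ~: O | ~~ ret v]|.
  rewrite -{1}cardK -(cardsID [set v | ret v]).
  have -> : ~: O :&: [set v | ret v] = [set v in ~: O | ret v].
    by apply/setP => v; rewrite !inE.
  by rewrite addKn; apply: eq_card => v; rewrite !inE andbC.
rewrite -sum1dep_card expn_sum big_mkcondr /=; apply: eq_bigr => v.
rewrite inE => vS.
have -> : [set u in ~: O | u <= v] = [set u in ~: O | u < v.+1] by [].
rewrite (setE v (ltnW (ltn_ord v))) (setS v.+1 (ltn_ord v)) /ret.
have <- : count_mem East (take v.+1 p) = count_mem East (take v p).
  rewrite (take_nth East) ?size_tuple // -cats1 count_cat -tnth_nth /=.
  by move: vS; rewrite !inE; case: (tnth _ _); rewrite ?addn0.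
have := le_SE v.+1 (ltn_ord v); rewrite /opener_weight leq_eqVlt.
by case/predU1P => [->|lt]; rewrite ?ltnn ?eqxx // lt ltn_eqF.
Qed.

Section PartitionArcs.

Variable n : nat.
Implicit Types (P Q : {set {set 'I_n}}) (A : {set 'I_n * 'I_n}).

Definition arc_rel A : rel 'I_n := fun x y => (x, y) \in A.
Definition arc_sym A : rel 'I_n := fun x y => ((x, y) \in A) || ((y, x) \in A).

Lemma mem_arcs P (x y : 'I_n) : partition P [set: 'I_n] ->
  reflect [/\ x < y, y \in pblock P x &
              forall z, z \in pblock P x -> x < z -> ~~ (z < y)]
          ((x, y) \in arcs P).
Proof.
case/and3P=> /eqP covP trivP _; have covx z : z \in cover P by rewrite covP inE.
rewrite inE /=; apply: (iffP andP) => [[xy /exists_inP[B PB /and3P[Bx By H]]]|[xy Py H]].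
  rewrite (def_pblock trivP PB Bx); split=> // z Bz xz; apply: contra H => zy.
  by apply/exists_inP; exists z; rewrite // xz.
split=> //; apply/exists_inP; exists (pblock P x); first exact: pblock_mem.
rewrite mem_pblock covx Py /=; apply/exists_inP => -[z Pz /andP[xz zy]].
by have := H z Pz xz; rewrite zy.
Qed.

Lemma arcs_diagram P : partition P [set: 'I_n] -> arc_diagram (arcs P).
Proof.
move=> partP; have /and3P[/eqP covP trivP _] := partP.
have covx z : z \in cover P by rewrite covP inE.
apply/arc_diagramP; split.
- by move=> x y /(mem_arcs _ _ partP)[].
- move=> [x y] [x' y'] /(mem_arcs _ _ partP)[xy Py Hy] /(mem_arcs _ _ partP)[xy' Py' Hy'] /= eq_x.
  subst x'; congr (_, _); apply: val_inj; apply/eqP; rewrite eqn_leq leqNgt Hy //=.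
  by rewrite leqNgt Hy'.
- move=> [x y] [x' y'] /(mem_arcs _ _ partP)[xy Py Hy] /(mem_arcs _ _ partP)[xy' Py' Hy'] /= eq_y.
  subst y'; congr (_, _); apply: val_inj; apply/eqP.
  have eqB : pblock P x = pblock P x'.
    by rewrite -(same_pblock trivP Py) (same_pblock trivP Py').
  have Bx : x \in pblock P x by rewrite mem_pblock.
  have Bx' : x' \in pblock P x' by rewrite mem_pblock.
  rewrite eqn_leq; apply/andP; split; rewrite leqNgt; apply/negP => lt.
    by have := Hy' x; rewrite -eqB Bx xy => /(_ isT lt).
  by have := Hy x'; rewrite eqB Bx' xy' => /(_ isT lt).
Qed.

Lemma pblock_connect P (x y : 'I_n) : partition P [set: 'I_n] ->
  (y \in pblock P x) = connect (arc_sym (arcs P)) x y.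
Proof.
move=> partP; have /and3P[/eqP covP trivP _] := partP.
have covx z : z \in cover P by rewrite covP inE.
have pbC a b : (b \in pblock P a) = (a \in pblock P b).
  by rewrite -!eq_pblock // eq_sym.
apply/idP/idP => [Py|/connectP[p]]; last first.
  elim: p x => [|z p IHp] x /=; first by move=> _ ->; rewrite mem_pblock.
  case/andP=> xz zp eq_y; have Pz : z \in pblock P x.
    by case/orP: xz => /(mem_arcs _ _ partP)[_ ? _] //; rewrite pbC.
  by rewrite -(same_pblock trivP Pz); apply: IHp.
have symC : connect_sym (arc_sym (arcs P)).
  by apply: sym_connect_sym => a b; rewrite /arc_sym orbC.
wlog xy : x y Py / x <= y.
  by move=> IH; case/orP: (leq_total x y) => ?; [apply: IH|rewrite symC; apply: IH; rewrite // pbC].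
have [k] := ubnP (y - x); elim: k x Py xy => // k IHk x Py xy lt_k.
have [/val_inj<-|lt_xy] := eqVneq (x : nat) y; first exact: connect0.
have {xy}lt_xy : x < y by rewrite ltn_neqAle lt_xy.
have [z /andP[Pz xz] zmin] := @arg_minnP _ y (fun z => (z \in pblock P x) && (x < z))
   (fun z : 'I_n => z : nat) (introT andP (conj Py lt_xy)).
have zy : z <= y by apply: zmin; rewrite Py.
apply: (connect_trans (y := z)).
  apply/connect1/orP; left; apply/(mem_arcs _ _ partP); split=> // w Pw xw.
  by rewrite -leqNgt zmin // Pw.
by apply: IHk => //; [rewrite (same_pblock trivP Pz)|lia].
Qed.

Lemma arcs_inj : {in [pred P | partition P [set: 'I_n]] &, injective (@arcs n)}.
Proof.
have half P Q : partition P [set: 'I_n] -> partition Q setT -> arcs P = arcs Q ->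
    P \subset Q.
  move=> partP partQ eq_PQ; apply/subsetP => B PB.
  have /and3P[_ trivP P0] := partP; have /and3P[/eqP covQ _ _] := partQ.
  have /set0Pn[x Bx] : B != set0 by apply: contraNneq P0 => <-.
  rewrite -(def_pblock trivP PB Bx).
  have -> : pblock P x = pblock Q x.
    by apply/setP => y; rewrite !pblock_connect // eq_PQ.
  by rewrite pblock_mem // covQ inE.
move=> P Q partP partQ eq_PQ; apply/eqP.
by rewrite eqEsubset !half.
Qed.

Section Components.

Variable A : {set 'I_n * 'I_n}.
Hypothesis diagA : arc_diagram A.

Lemma connect_arc_first x z : connect (arc_rel A) x z ->
  x = z \/ exists2 y, (x, y) \in A & connect (arc_rel A) y z.
Proof.
case/connectP=> -[|y p] /=; first by left.
by case/andP=> xy yp eq_z; right; exists y => //; apply/connectP; exists p.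
Qed.

Lemma connect_arc_last x z : connect (arc_rel A) x z ->
  x = z \/ exists2 y, connect (arc_rel A) x y & (y, z) \in A.
Proof.
case/connectP=> p; case/lastP: p => [|p y] /=; first by left.
rewrite rcons_path last_rcons => /andP[xp py] ->; right.
by exists (last x p) => //; apply/connectP; exists p.
Qed.

Lemma connect_arc_le x z : connect (arc_rel A) x z -> x <= z.
Proof.
have /arc_diagramP[up _ _] := diagA.
case/connectP=> p; elim: p x => [|y p IHp] x /=; first by move=> _ ->.
by case/andP=> /up xy yp eq_z; apply: leq_trans (ltnW xy) (IHp _ yp eq_z).
Qed.

Lemma connect_arc_sym x z : connect (arc_sym A) x z ->
  connect (arc_rel A) x z || connect (arc_rel A) z x.
Proof.
have /arc_diagramP[_ injl injr] := diagA.
case/connectP=> p; elim: p x => [|y p IHp] x /=; first by move=> _ ->; rewrite connect0.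
case/andP=> xy yp eq_z; have {IHp} := IHp y yp eq_z; case/orP: xy => Axy /orP[] cyz.
- by rewrite (connect_trans (connect1 _) cyz).
- case: (connect_arc_last cyz) => [->|[w czw Awy]]; first by rewrite connect1.
  by have [<-] := injr _ _ Awy Axy erefl; rewrite czw orbT.
- case: (connect_arc_first cyz) => [<-|[w Ayw cwz]]; first by rewrite (connect1 Axy) orbT.
  by have [<-] := injl _ _ Ayw Axy erefl; rewrite cwz.
- by rewrite (connect_trans cyz (connect1 Axy)) orbT.
Qed.

Lemma arcs_components :
  exists2 P, partition P [set: 'I_n] & arcs P = A.
Proof.
have /arc_diagramP[up injl injr] := diagA.
have symC : connect_sym (arc_sym A).
  by apply: sym_connect_sym => a b; rewrite /arc_sym orbC.
have eqR : {in [set: 'I_n] & &, equivalence_rel (connect (arc_sym A))}.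
  by move=> x y z _ _ _; split=> [|cxy]; [exact: connect0|exact: same_connect].
pose P := equivalence_partition (connect (arc_sym A)) [set: 'I_n].
have partP : partition P [set: 'I_n] by exact: equivalence_partitionP.
have pbE x y : (y \in pblock P x) = connect (arc_sym A) x y.
  by rewrite pblock_equivalence_partition ?inE.
exists P => //; apply/setP => -[x y]; apply/(mem_arcs _ _ partP)/idP => [[xy]|Axy].
  rewrite pbE => /connect_arc_sym/orP[cxy|/connect_arc_le]; last by rewrite leqNgt xy.
  case: (connect_arc_first cxy) => [eq_xy|[z Axz czy]] H.
    by rewrite eq_xy ltnn in xy.
  have := H z; rewrite pbE connect1 /arc_sym ?Axz // => /(_ isT (up _ _ Axz)).
  rewrite -leqNgt => le_yz; have le_zy := connect_arc_le czy.
  by have <- : z = y by apply: val_inj; apply/eqP; rewrite eqn_leq le_yz le_zy.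
split=> [||z]; first exact: up.
  by rewrite pbE connect1 // /arc_sym Axy.
rewrite pbE => /connect_arc_sym/orP[cxz xz|/connect_arc_le]; last by case: ltngtP.
case: (connect_arc_first cxz) => [eq_xz|[w Axw cwz]].
  by rewrite eq_xz ltnn in xz.
rewrite -leqNgt; have [<-] := injl _ _ Axw Axy erefl.
exact: connect_arc_le.
Qed.

End Components.

Lemma card_partitions_typed sigma tau :
  #|partitions n sigma tau| = #|typed_diagrams n predT sigma tau|.
Proof.
rewrite -(card_in_imset (f := @arcs n)); last first.
  by move=> P Q; rewrite !inE => /andP[partP _] /andP[partQ _]; apply: arcs_inj.
apply: eq_card => A; apply/imsetP/idP => [[P]|].
  rewrite inE => /and3P[partP av1 av2] ->; rewrite inE arcs_diagram // av1 av2 !andbT.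
  exact/forallP.
rewrite inE => /and4P[diagA _ av1 av2].
have [P partP eqA] := arcs_components diagA.
by exists P; rewrite // inE partP eqA av1.
Qed.

End PartitionArcs.

(** * Generating functions *)

Lemma total_weight_matching_gt N h : N < h -> total_weight matching_type N h 0 = 0.
Proof.
elim: N h => [|N IHN] h ltNh; first by rewrite total_weight0; case: h ltNh.
rewrite total_weight_matchingS IHN ?muln0; last by lia.
by case: h ltNh => // h ltNh; rewrite IHN.
Qed.

Local Open Scope ring_scope.

Lemma total_weight_matchingP (G : nat -> nat -> rat) :
    G 0 0 = 1 -> (forall k, G 0 k.+1 = G 1 k) -> (forall h, G h.+1 0 = G h 0) ->
    (forall h k, G h.+1 k.+1 = G h k.+1 + 2 * G h.+2 k) ->
  forall h k, (total_weight matching_type (k.*2 + h) h 0)%:R = G h k.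
Proof.
move=> G00 G0S GS0 GSS h k; have [N] := ubnP (k.*2 + h)%N.
elim: N h k => // N IHN [|h] [|k] ltN.
- by rewrite total_weight0 G00.
- rewrite doubleS addn0 total_weight_matchingS addn0 /= mul1n G0S -IHN; last by lia.
  by rewrite addn1.
- rewrite add0n total_weight_matchingS total_weight_matching_gt ?muln0 ?add0n //.
  by rewrite GS0 -IHN ?add0n; last by lia.
- rewrite addnS total_weight_matchingS GSS -!IHN; [|lia..].
  rewrite natrD addrC; congr (_ + _); rewrite natrM; congr (_ * (_ _ _ _ _)%:R).
  by rewrite doubleS; lia.
Qed.

Lemma total_weight_partitionP (G : nat -> nat -> rat) :
    (forall h, G h 0 = (h == 0)%:R) -> (forall n, G 0 n.+1 = G 0 n + G 1 n) ->
    (forall n, G 1 n.+1 = 2 * G 1 n + 2 * G 2 n + G 0 n) ->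
    (forall h n, G h.+2 n.+1 = 3 * G h.+2 n + 2 * G h.+3 n + G h.+1 n) ->
  forall h n, (total_weight predT n h 0)%:R = G h n.
Proof.
move=> G0 G0S G1S GSS h n; elim: n h => [|n IHn] h; first by rewrite total_weight0 G0.
rewrite total_weight_partitionS; case: h => [|[|h]] /=.
- by rewrite mul1n addn0 natrD !IHn G0S.
- by rewrite !mul1n !(natrM, natrD) !IHn G1S; ring.
- by rewrite !(natrM, natrD) !IHn GSS; ring.
Qed.

Section Fps.

Implicit Types a b : fps rat.
Let z : fps rat := fpsX rat.

Lemma fps_coefD a b n : fps_coef (a + b) n = fps_coef a n + fps_coef b n.
Proof. by []. Qed.

Lemma fps_coefN a n : fps_coef (- a) n = - fps_coef a n.
Proof. by []. Qed.

Lemma fps_coefM a b n :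
  fps_coef (a * b) n = \sum_(i < n.+1) fps_coef a i * fps_coef b (n - i).
Proof. by []. Qed.

Lemma fps_coef0M a b : fps_coef (a * b) 0 = fps_coef a 0 * fps_coef b 0.
Proof. by rewrite fps_coefM big_ord_recl big_ord0 addr0. Qed.

Lemma fps_coef1 n : fps_coef (1 : fps rat) n = (n == 0)%:R.
Proof. by []. Qed.

Lemma fps_coef01 : fps_coef (1 : fps rat) 0 = 1.
Proof. by []. Qed.

Lemma fps_coefMn a m n : fps_coef (a *+ m) n = fps_coef a n *+ m.
Proof. by elim: m => // m IHm; rewrite !mulrS fps_coefD IHm. Qed.

Lemma fps_coef_natM a m n : fps_coef (m%:R * a) n = m%:R * fps_coef a n.
Proof. by rewrite !mulr_natl fps_coefMn. Qed.

Lemma fps_coef0_nat m : fps_coef (m%:R : fps rat) 0 = m%:R.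
Proof. by rewrite fps_coefMn. Qed.

Lemma fps_coefXM a n : fps_coef (z * a) n = if n is m.+1 then fps_coef a m else 0.
Proof.
rewrite fps_coefM; case: n => [|n]; first by rewrite big_ord_recl big_ord0 mul0r addr0.
rewrite 2!big_ord_recl /= mul0r add0r mul1r big1 ?addr0; last first.
  by move=> i _; rewrite mul0r.
by rewrite subSS subn0.
Qed.

Lemma fps_coefX0 : fps_coef z 0 = 0.
Proof. by []. Qed.

Lemma fps_unitE a : (a \is a GRing.unit) = (fps_coef a 0 != 0).
Proof. by rewrite -unitfE. Qed.

Lemma fps_coef0X a n : fps_coef (a ^+ n) 0 = fps_coef a 0 ^+ n.
Proof. by elim: n => // n IHn; rewrite !exprS fps_coef0M IHn. Qed.

Lemma fps_coef0V a : fps_coef a 0 != 0 -> fps_coef (a^-1) 0 = (fps_coef a 0)^-1.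
Proof.
move=> a0; have ua : a \is a GRing.unit by rewrite fps_unitE.
by apply: (mulfI a0); rewrite -fps_coef0M divrr // mulfV.
Qed.

Definition fps_coef0E := (fps_coefD, fps_coefN, fps_coef0M, fps_coef0_nat, fps_coef01,
  fps_coef0X, fps_coefX0, fps_sqrt0).

Lemma fps_nat_unit m : (0 < m)%N -> (m%:R : fps rat) \is a GRing.unit.
Proof. by case: m => // m _; rewrite fps_unitE fps_coef0_nat Num.Theory.pnatr_eq0. Qed.

Lemma fps_sqrt_sqr a : fps_coef a 0 = 1 -> fps_sqrt a ^+ 2 = a.
Proof. by move=> a0; apply: fps_sqrtK => //; rewrite unitfE. Qed.

Lemma matchings_series sigma tau : is_pattern_pair sigma tau ->
  Fps (fun n => #|matchings n sigma tau|%:R : rat) =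
  4 / (3 + fps_sqrt (1 - 8 * z)).
Proof.
move=> pat; set S := fps_sqrt _.
have sqS : S ^+ 2 = 1 - 8 * z by apply: fps_sqrt_sqr; rewrite !fps_coef0E; ring.
have u3 : 3 + S \is a GRing.unit by rewrite fps_unitE !fps_coef0E.
have u1 : 1 + S \is a GRing.unit by rewrite fps_unitE !fps_coef0E.
pose C := 2 / (1 + S); pose M := 4 / (3 + S); rewrite -/M.
have CE : C * (1 + S) = 2 by rewrite divrK.
have ME : M * (3 + S) = 4 by rewrite divrK.
have C4 : 4 * z * C = 1 - S.
  apply: (mulIr u1); rewrite -[LHS]mulrA CE.
  have -> : (1 - S) * (1 + S) = 1 - S ^+ 2 by ring.
  by rewrite sqS; ring.
have Crec : C = 1 + 2 * z * C ^+ 2.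
  apply: (mulIr u1); rewrite CE.
  have -> : (1 + 2 * z * C ^+ 2) * (1 + S) = 1 + S + 2 * z * C * (C * (1 + S)) by ring.
  rewrite CE; have -> : 1 + S + 2 * z * C * 2 = 1 + S + 4 * z * C by ring.
  by rewrite C4; ring.
have Mrec : M = 1 + z * (M * C).
  apply: (mulrI (fps_nat_unit (isT : 0 < 4)%N)).
  have -> : 4 * (1 + z * (M * C)) = 4 + M * (4 * z * C) by ring.
  by rewrite C4 -[X in X + _]ME; ring.
have C0 : fps_coef C 0 = 1.
  by rewrite Crec -!mulrA fps_coefD fps_coef_natM fps_coefXM mulr0 addr0.
have M0 : fps_coef M 0 = 1 by rewrite Mrec fps_coefD fps_coefXM addr0.
apply: fpsP => n /=; rewrite matchings_typed card_typed_diagrams //.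
rewrite -[X in total_weight _ X]addn0.
rewrite (@total_weight_matchingP (fun h k => fps_coef (M * C ^+ h) k)).
- by rewrite mulr1.
- by rewrite mulr1.
- by move=> k; rewrite mulr1 expr1 {1}Mrec fps_coefD fps_coefXM add0r.
- by move=> h; rewrite !fps_coef0M !fps_coef0X C0 !expr1n.
- move=> h k; have -> : M * C ^+ h.+1 = M * C ^+ h + 2 * (z * (M * C ^+ h.+2)).
    by rewrite exprSr {2}Crec !exprS; ring.
  by rewrite fps_coefD fps_coef_natM fps_coefXM.
Qed.

Lemma partitions_series sigma tau : is_pattern_pair sigma tau ->
  Fps (fun n => #|partitions n sigma tau|%:R : rat) =
  (2 - 3 * z + z ^+ 2 - z * fps_sqrt (1 - 6 * z + z ^+ 2)) /
  (2 * (1 - 3 * z + 3 * z ^+ 2)).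
Proof.
move=> pat; set S := fps_sqrt _.
have sqS : S ^+ 2 = 1 - 6 * z + z ^+ 2.
  by apply: fps_sqrt_sqr; rewrite !fps_coef0E; ring.
pose D := 1 - 3 * z + S.
have uD : D \is a GRing.unit by rewrite fps_unitE !fps_coef0E.
pose q := 2 * z / D; have qE : q * D = 2 * z by rewrite divrK.
have q4 : 4 * z * q = 1 - 3 * z - S.
  apply: (mulIr uD); rewrite -[LHS]mulrA qE.
  have -> : (1 - 3 * z - S) * D = (1 - 3 * z) ^+ 2 - S ^+ 2 by rewrite /D; ring.
  by rewrite sqS; ring.
have qrec : q = z * (1 + 3 * q + 2 * q ^+ 2).
  apply: (mulIr uD).
  have -> : z * (1 + 3 * q + 2 * q ^+ 2) * D =
            z * (D + 3 * (q * D) + 2 * q * (q * D)) by ring.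
  rewrite qE; have -> : z * (D + 3 * (2 * z) + 2 * q * (2 * z)) =
     z * (D + 6 * z + 4 * z * q) by ring.
  by rewrite q4 /D; ring.
pose W := 1 - 2 * z - 2 * z * q; pose E := (1 - z) * W - z ^+ 2.
have uE : E \is a GRing.unit.
  by rewrite fps_unitE !fps_coef0E !(mulr0, mul0r, subr0, mulr1).
pose Z0 := W / E; pose Z1 := z / E.
have Z0E : Z0 * E = W by rewrite divrK.
have Z1E : Z1 * E = z by rewrite divrK.
have Z0rec : Z0 = 1 + z * (Z0 + Z1).
  apply: (mulIr uE).
  have -> : (1 + z * (Z0 + Z1)) * E = E + z * (Z0 * E + Z1 * E) by ring.
  by rewrite Z0E Z1E /E; ring.
have Z1rec : Z1 = z * (2 * Z1 + 2 * (Z1 * q) + Z0).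
  apply: (mulIr uE).
  have -> : z * (2 * Z1 + 2 * (Z1 * q) + Z0) * E =
            z * (2 * (Z1 * E) + 2 * q * (Z1 * E) + Z0 * E) by ring.
  by rewrite Z0E Z1E /W; ring.
have eqZ0 : (2 - 3 * z + z ^+ 2 - z * S) / (2 * (1 - 3 * z + 3 * z ^+ 2)) = Z0.
  set U := 2 * _; set num := _ - z * S.
  have u : U \is a GRing.unit by rewrite fps_unitE !fps_coef0E.
  apply: (mulIr u); rewrite divrK //; apply: (mulIr uE).
  have -> : Z0 * U * E = U * (Z0 * E) by ring.
  rewrite Z0E; apply: (mulrI (fps_nat_unit (isT : 0 < 2)%N)).
  have W2 : 2 * W = 1 - z + S.
    have -> : 2 * W = 2 - 4 * z - 4 * z * q by rewrite /W; ring.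
    by rewrite q4; ring.
  have E2 : 2 * E = (1 - z) * (1 - z + S) - 2 * z ^+ 2 by rewrite -W2 /E; ring.
  have -> : 2 * (num * E) = num * (2 * E) by ring.
  have -> : 2 * (U * W) = U * (2 * W) by ring.
  rewrite E2 W2; apply/eqP; rewrite -subr_eq0; apply/eqP.
  transitivity (z * (1 - z) * ((1 - 6 * z + z ^+ 2) - S ^+ 2)).
    by rewrite /num /U; ring.
  by rewrite sqS subrr mulr0.
rewrite {}eqZ0; apply: fpsP => n; rewrite [LHS]/= card_partitions_typed.
rewrite card_typed_diagrams //.
pose Z h := if h is h'.+1 then Z1 * q ^+ h' else Z0.
have ZS1 : Z 1%N = Z1 by exact: mulr1.
have ZS2 : Z 2%N = Z1 * q by [].
rewrite (@total_weight_partitionP (fun h k => fps_coef (Z h) k)) //.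
- case=> [|h]; first by rewrite [Z 0%N]/Z Z0rec fps_coefD fps_coefXM addr0.
  by rewrite /Z -mulrA fps_coefXM.
- move=> k; rewrite [Z 0%N]/Z {1}Z0rec fps_coefD fps_coefXM fps_coef1 add0r.
  by rewrite fps_coefD ZS1.
- move=> k; rewrite ZS1 ZS2 [in LHS]Z1rec fps_coefXM.
  by rewrite !fps_coefD !fps_coef_natM.
- move=> h k; rewrite /Z.
  have Zrec : Z1 * q ^+ h.+1 =
      z * (3 * (Z1 * q ^+ h.+1) + 2 * (Z1 * q ^+ h.+2) + Z1 * q ^+ h).
    by rewrite {1}exprSr {2}qrec !exprS; ring.
  by rewrite [in LHS]Zrec fps_coefXM !fps_coefD !fps_coef_natM.
Qed.

Definition fps_theta a : fps rat := Fps (fun n => n%:R * fps_coef a n).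

Lemma fps_thetaD a b : fps_theta (a + b) = fps_theta a + fps_theta b.
Proof. by apply: fpsP => n /=; rewrite mulrDr. Qed.

Lemma fps_thetaM a b : fps_theta (a * b) = fps_theta a * b + a * fps_theta b.
Proof.
apply: fpsP => n; rewrite fps_coefD !fps_coefM /= big_distrr -big_split /=.
apply: eq_bigr => i _; rewrite -{1}(subnKC (ltn_ord i : (i <= n)%N)) natrD; ring.
Qed.

Lemma fps_theta1 : fps_theta 1 = 0.
Proof. by apply: fpsP => -[|n] /=; rewrite ?mul0r ?mulr0. Qed.

Lemma fps_thetaX : fps_theta z = z.
Proof. by apply: fpsP => -[|[|n]] /=; rewrite ?mul0r ?mulr1 ?mulr0. Qed.

Lemma fps_thetaXn a n : fps_theta (a ^+ n.+1) = n.+1%:R * a ^+ n * fps_theta a.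
Proof.
elim: n => [|n IHn]; first by rewrite !mul1r.
by rewrite exprS fps_thetaM IHn -[n.+2]addn1 natrD exprS; ring.
Qed.

Let V : fps rat := (1 - z)^-1.

Lemma geometricE : V * (1 - z) = 1.
Proof. by rewrite mulVr // fps_unitE !fps_coef0E. Qed.

Lemma geometricS m : V ^+ m.+1 * (1 - z) = V ^+ m.
Proof. by rewrite exprSr -mulrA geometricE mulr1. Qed.

Lemma fps_theta_geometric : fps_theta V = z * V ^+ 2.
Proof.
have := congr1 fps_theta geometricE.
rewrite fps_thetaM fps_theta1 fps_thetaD fps_theta1 add0r.
have -> : fps_theta (- z) = - z by rewrite -[in RHS]fps_thetaX; apply: fpsP => n /=; rewrite mulrN.
move=> eqV; transitivity ((fps_theta V * (1 - z) + V * - z) * V + z * V ^+ 2).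
  have -> : (fps_theta V * (1 - z) + V * - z) * V + z * V ^+ 2 =
     fps_theta V * (V * (1 - z)) by ring.
  by rewrite geometricE mulr1.
by rewrite eqV mul0r add0r.
Qed.

Lemma coef_geometric m k : fps_coef (V ^+ m.+1) k = 'C(m + k, k)%:R.
Proof.
have rec p j : fps_coef (V ^+ p.+1) j.+1 =
    fps_coef (V ^+ p.+1) j + fps_coef (V ^+ p) j.+1.
  rewrite -[V ^+ p]geometricS mulrBr mulr1 fps_coefD fps_coefN mulrC fps_coefXM; ring.
elim: m k => [|m IHm]; elim=> [|k IHk].
- by rewrite fps_coef0X fps_coef0V !fps_coef0E // subr0 invr1.
- by rewrite rec IHk !add0n !binn fps_coef1 addr0.
- by rewrite fps_coef0X fps_coef0V !fps_coef0E // subr0 invr1 expr1n bin0.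
- by rewrite rec IHk IHm -natrD [in RHS]addnS [in RHS]binS addSnnS addnC.
Qed.

Lemma coef_one_plus_X m i : fps_coef ((1 + z) ^+ m) i = 'C(m, i)%:R.
Proof.
elim: m i => [|m IHm] [|i] //.
- by rewrite fps_coef0X !fps_coef0E addr0 expr1n bin0.
- by rewrite exprS mulrDl mul1r fps_coefD fps_coefXM !IHm binS natrD.
Qed.

(* The paths starting at height [h] have generating function
   [(1 + u)^(h + 1) / (1 - u)^h], where [u = z (1 + u)^2 / (1 - u)].  Lagrange
   inversion writes its [k]-th coefficient in [z] as the [k]-th coefficient in [u]
   of the series below, which is easily checked against the recurrence of paths
   (here [z] plays the role of [u]). *)
Definition lagrange_term (h k : nat) : fps rat :=
  (1 - 3 * z) * (1 + z) ^+ (k.*2 + h) * V ^+ (h + k).+1.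

Lemma lagrange_boundary k :
  fps_coef ((1 - 3 * z) * (1 + z) ^+ (k.*2.+1) * V ^+ k.+2) k =
  k.+1%:R^-1 * fps_coef ((1 + z) ^+ (k.*2.+2) * V ^+ k.+1) k /\
  fps_coef ((1 - 3 * z) * (1 + z) ^+ (k.*2.+1) * V ^+ k.+2) k.+1 = 0.
Proof.
set B := _ * V ^+ k.+2; set psi := _ * V ^+ k.+1.
have K0 : k.+1%:R != 0 :> rat by rewrite Num.Theory.pnatr_eq0.
have key : fps_theta psi = k.+1%:R * psi - k.+1%:R * B.
  have k2 : (k.*2.+2)%:R = 2 * k.+1%:R :> fps rat by rewrite -doubleS -muln2 natrM mulrC.
  rewrite /psi fps_thetaM !fps_thetaXn fps_theta_geometric fps_thetaD.
  rewrite fps_theta1 fps_thetaX add0r k2 /B [_ ^+ k.*2.+2]exprS [V ^+ k.+2]exprS.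
  rewrite [V ^+ k.+1]exprS; set X := (1 + z) ^+ _; set Y := V ^+ k.
  apply/eqP; rewrite -subr_eq0; apply/eqP.
  transitivity (k.+1%:R * X * Y * (z - 1) * V * (1 - V * (1 - z))); first by ring.
  by rewrite geometricE subrr mulr0.
have coefK n : n%:R * fps_coef psi n = k.+1%:R * (fps_coef psi n - fps_coef B n).
  have := congr1 (fun a => fps_coef a n) key.
  by rewrite fps_coefD fps_coefN !fps_coef_natM mulrBr.
split; apply: (mulfI K0).
  rewrite mulrA divff // mul1r; have := coefK k; rewrite -natr1 => eq_k.
  transitivity ((k%:R + 1) * fps_coef psi k - k%:R * fps_coef psi k); last by ring.
  by rewrite eq_k; ring.
apply/eqP; rewrite mulr0 -[_ * _]opprK oppr_eq0; apply/eqP.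
transitivity (k.+1%:R * (fps_coef psi k.+1 - fps_coef B k.+1) - k.+1%:R * fps_coef psi k.+1).
  by ring.
by rewrite -coefK subrr.
Qed.

Lemma total_weight_lagrange h k :
  (total_weight matching_type (k.*2 + h) h 0)%:R = fps_coef (lagrange_term h k) k.
Proof.
have V0 : fps_coef V 0 = 1 by rewrite fps_coef0V !fps_coef0E // subr0 invr1.
apply: (@total_weight_matchingP (fun h k => fps_coef (lagrange_term h k) k)).
- by rewrite /lagrange_term expr1 expr0 !fps_coef0E V0.
- move=> {h}k; have [_ eq0] := lagrange_boundary k.
  have -> : lagrange_term 0 k.+1 =
      (1 - 3 * z) * (1 + z) ^+ k.*2.+1 * V ^+ k.+2 + z * lagrange_term 1 k.
    rewrite /lagrange_term add0n addn0 doubleS addn1 add1n [_ ^+ k.*2.+2]exprS.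
    ring.
  by rewrite fps_coefD eq0 fps_coefXM add0r.
- by move=> {}h; rewrite /lagrange_term !fps_coef0E V0 !(addr0, expr1n).
- move=> {}h {}k; have -> : lagrange_term h.+1 k.+1 =
      lagrange_term h k.+1 + 2 * (z * lagrange_term h.+2 k).
    rewrite /lagrange_term -[V ^+ (h + k.+1).+1]geometricS doubleS !addnS !addSn.
    rewrite [_ ^+ (_ + h).+3]exprS; ring.
  by rewrite fps_coefD fps_coef_natM fps_coefXM.
Qed.

Lemma card_matchingsS sigma tau n : is_pattern_pair sigma tau ->
  #|matchings n.+1 sigma tau|%:R =
  n.+1%:R^-1 * \sum_(0 <= k < n.+1) ('C(2 * n + 2, n - k) * 'C(n + k, k))%N%:R :> rat.
Proof.
move=> pat; rewrite matchings_typed card_typed_diagrams // doubleS.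
rewrite total_weight_matchingS mul1n addn0 -addn1 total_weight_lagrange.
rewrite /lagrange_term addn1 add1n; have [-> _] := lagrange_boundary n.
congr (_ * _); rewrite mulrC fps_coefM big_mkord; apply: eq_bigr => k _.
by rewrite coef_geometric coef_one_plus_X natrM mulrC -addn2 -mul2n.
Qed.

End Fps.

Theorem theorem6p1 :
  (forall sigma tau : 'S_3, is_pattern_pair sigma tau ->
     [/\ (forall (n : nat) (F : {set 'I_n * 'I_n}), F \in dyck_boards n ->
            #|matchings_of_shape F sigma tau| = (2 ^ (n - returns F))%N),
         (let z := fpsX rat in
          Fps (fun n => #|matchings n sigma tau|%:R : rat) =
          4 / (3 + fps_sqrt (1 - 8 * z))),
         (forall n : nat,
            #|matchings n.+1 sigma tau|%:R =
            n.+1%:R^-1 *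
            \sum_(0 <= k < n.+1)
              ('C(2 * n + 2, n - k) * 'C(n + k, k))%N%:R :> rat)
       & (let z := fpsX rat in
          Fps (fun n => #|partitions n sigma tau|%:R : rat) =
          (2 - 3 * z + z ^+ 2 - z * fps_sqrt (1 - 6 * z + z ^+ 2)) /
          (2 * (1 - 3 * z + 3 * z ^+ 2)))]) /\
  (forall sigma tau sigma' tau' : 'S_3,
     is_pattern_pair sigma tau -> is_pattern_pair sigma' tau' ->
     shape_wilf_equivalent sigma tau sigma' tau').
Proof.
split=> [sigma tau pat|sigma tau sigma' tau' pat pat' n F _].
  split=> [n F||n|].
  - exact: card_matchings_of_shape.
  - exact: matchings_series.
  - exact: card_matchingsS.
  - exact: partitions_series.
have [Fdyck|F'] := boolP (F \in dyck_boards n).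
  by rewrite !card_matchings_of_shape.
have empty (s t : 'S_3) : matchings_of_shape F s t = set0.
  by apply/setP => M; rewrite in_set0 inE /has_shape (negbTE F') andbF.
by rewrite !empty.
Qed.
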